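(* Let $F$ be a bivariate probability distribution on $\mathbb{R}^2$ with marginal distributions $\mu$ and $\nu$ (both in $Cra$, hence identifiable by their moments), absolutely continuous with respect to $\mu\times\nu$ and satisfying $$\int_{\operatorname{supp}\mu}\int_{\operatorname{supp}\nu}\Big(\frac{\partial^2F}{\partial\mu\,\partial\nu}(x,y)\Big)^2d\mu(x)\,d\nu(y)<\infty ,$$ where $\frac{\partial^2F}{\partial\mu\,\partial\nu}$ denotes the Radon–Nikodym derivative of $F$ with respect to $\mu\times\nu$. Then $F$ is an LC distribution if and only if it is a PC distribution.
   Context: $Cra$ is the set of all signed measures $\chi$ on $\mathbb{R}$ for which there exists $\delta>0$ with $\int\exp(\delta|x|)\,d|\chi|(x)<\infty$. Let $\{\alpha_n\}_{n\ge0}$ and $\{\beta_n\}_{n\ge0}$ be the polynomials orthogonal with respect to $\mu$ and $\nu$ respectively ($\deg\alpha_n=\deg\beta_n=n$). Let $(X,Y)$ be a random vector with distribution $F$, $X\sim\mu$, $Y\sim\nu$. LC (Lancaster class): $F$ with margins identifiable by moments and satisfying the square-integrability condition in the claim is an LC distribution if there are numbers $\{c_n\}_{n\ge0}$ such that $$dF(x,y)=d\mu(x)\,d\nu(y)\sum_{n\ge0}c_n\alpha_n(x)\beta_n(y)$$ almost everywhere on $\operatorname{supp}(\mu)\times\operatorname{supp}(\nu)$ with respect to the product measure $\mu\times\nu$ (the series converging in mean square with respect to $\mu\times\nu$). PC (polynomial class): $F$ with margins identifiable by moments is a PC distribution if all its conditional moments of order $n$ are polynomials of full order $n$ in the conditioning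 variable: for every $n\ge1$, $E(X^n|Y)=p_n(Y)$ $\nu$-a.s. and $E(Y^n|X)=q_n(X)$ $\mu$-a.s., where $p_n,q_n$ are polynomials of full order $n$. A polynomial $p_n$ is of full order $n$ iff it has degree $n$, i.e. its coefficient at $x^n$ is nonzero.
   Formalization: LC additionally requires all coefficients c_n to be nonzero (F = μ×ν would otherwise be LC but not PC), and the orthogonal polynomials have nonzero norm in every degree, so μ and ν have infinite support. *)

(* Defs.v *)
From HB Require Import structures.
From mathcomp Require Import all_boot all_order all_algebra.
From mathcomp Require Import all_classical all_reals all_analysis.

Set Implicit Arguments.
Unset Strict Implicit.
Unset Printing Implicit Defensive.

Import Order.TTheory GRing.Theory Num.Theory.
Import numFieldNormedType.Exports.

Local Open Scope classical_set_scope.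
Local Open Scope ring_scope.

Notation RB R := (measurableTypeR R).

(* The integral does not depend on the choice of the Hahn decomposition (P, N)
   defining the total variation measure. *)
Definition Cra (R : realType) (chi : {charge set (RB R) -> \bar R}) : Prop :=
  exists (P N : set (RB R)) (chiPN : hahn_decomposition chi P N) (delta : R),
    0 < delta /\
    (\int[charge_variation chiPN]_x (expR (delta * `|x : R|))%:E < +oo)%E.

Definition msupport (R : realType) (mu : set (RB R) -> \bar R) : set (RB R) :=
  [set x : R | forall U : set R, open_nbhs x U -> (0 < mu U)%E].

Definition has_moments (R : realType) (mu : probability (RB R) R) : Prop :=
  forall n : nat, mu.-integrable setT (fun x => ((x : R) ^+ n)%:E).

Definition identifiable_by_moments (R : realType)
    (mu : probability (RB R) R) : Prop :=
  has_moments mu /\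
  forall mu' : probability (RB R) R, has_moments mu' ->
    (forall n : nat, (\int[mu']_x ((x : R) ^+ n)%:E =
                      \int[mu]_x ((x : R) ^+ n)%:E)%E) ->
    forall A : set (RB R), measurable A -> mu' A = mu A.

(* An orthogonal system consists of vectors of nonzero norm; as this is required
   for every degree, the support of mu is infinite. *)
Definition orthogonal_polynomials (R : realType) (mu : probability (RB R) R)
    (alpha : nat -> {poly R}) : Prop :=
  [/\ forall n, size (alpha n) = n.+1,
      forall m n, m != n ->
        (\int[mu]_x ((alpha m).[x] * (alpha n).[x])%:E = 0)%E &
      forall n, (0 < \int[mu]_x ((alpha n).[x] ^+ 2)%:E)%E].

Definition joint_density (R : realType) (mu nu : probability (RB R) R)
    (F : probability (RB R * RB R)%type R) : RB R * RB R -> \bar R :=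
  Radon_Nikodym (charge_of_finite_measure F)
    ((mu \x nu)%E : probability (RB R * RB R)%type R).

Definition square_integrable_density (R : realType)
    (mu nu : probability (RB R) R) (F : probability (RB R * RB R)%type R) : Prop :=
  (\int[mu]_(x in msupport mu) \int[nu]_(y in msupport nu)
     (joint_density mu nu F (x, y) ^+ 2) < +oo)%E.

(* The joint density is the mean-square sum [s] of
   \sum_n c_n alpha_n(x) beta_n(y). *)
Definition lancaster_expansion (R : realType) (mu nu : probability (RB R) R)
    (F : probability (RB R * RB R)%type R) (alpha beta : nat -> {poly R})
    (c : nat -> R) : Prop :=
  exists s : RB R * RB R -> R,
    [/\ measurable_fun setT s,
        (\int[(mu \x nu)%E]_z
            ((\sum_(n < N) c n * (alpha n).[z.1] * (beta n).[z.2] - s z) ^+ 2)%:E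
          @[N --> \oo] --> 0)%E &
        {ae (mu \x nu)%E, forall z, (msupport mu `*` msupport nu) z ->
           joint_density mu nu F z = (s z)%:E}].

(* The coefficients are required to be nonzero: conditional moments are of full
   order exactly when no degree is missing from the expansion.  The product law,
   for which c_n = 0 for all n >= 1, has constant conditional moments. *)
Definition LC (R : realType) (mu nu : probability (RB R) R)
    (F : probability (RB R * RB R)%type R)
    (alpha beta : nat -> {poly R}) : Prop :=
  [/\ identifiable_by_moments mu, identifiable_by_moments nu,
      F `<< (mu \x nu)%E, square_integrable_density mu nu F &
      exists c : nat -> R,
        (forall n, c n != 0) /\ lancaster_expansion mu nu F alpha beta c].

(* [g] is a Borel version of y |-> E(Z | Y = y): g(Y) is sigma(Y)-measurable and
   has the same integral as Z on every event {Y \in B}. *)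
Definition is_cond_expectation (R : realType) d (T : measurableType d)
    (P : probability T R) (Z Y : T -> R) (g : R -> R) : Prop :=
  [/\ P.-integrable setT (EFin \o Z),
      measurable_fun (setT : set (RB R)) (g : RB R -> RB R),
      P.-integrable setT (EFin \o (g \o Y)) &
      forall B : set (RB R), measurable B ->
        (\int[P]_(w in Y @^-1` B) (g (Y w))%:E =
         \int[P]_(w in Y @^-1` B) (Z w)%:E)%E].

Definition polynomial_cond_moments (R : realType) d (T : measurableType d)
    (P : probability T R) (X Y : T -> R) (nu : probability (RB R) R) : Prop :=
  forall n : nat, (1 <= n)%N ->
    exists p : {poly R}, size p = n.+1 /\
      exists g : R -> R, is_cond_expectation P (fun w => X w ^+ n) Y g /\
        {ae nu, forall y : R, g y = p.[y]}.

(* The random vector with distribution F is realized by the coordinates of the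
   plane under F. *)
Definition PC (R : realType) (mu nu : probability (RB R) R)
    (F : probability (RB R * RB R)%type R) : Prop :=
  [/\ identifiable_by_moments mu, identifiable_by_moments nu,
      polynomial_cond_moments F fst snd nu &
      polynomial_cond_moments F snd fst mu].

(* Main.v *)
Require Import Defs.
From HB Require Import structures.
From mathcomp Require Import all_boot all_order all_algebra.
From mathcomp Require Import all_classical all_reals all_analysis.
From mathcomp Require Import measurable_realfun ring lra.

Set Implicit Arguments.
Unset Strict Implicit.
Unset Printing Implicit Defensive.

Import Order.TTheory GRing.Theory Num.Theory.
Import numFieldNormedType.Exports.

Local Open Scope classical_set_scope.
Local Open Scope ring_scope.

(** Write [f] for the density of [F] with respect to [P = mu \x nu].  Testing
    against indicators of [Y], the regression [E(X^n | Y) = p_n(Y)] says that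
    [\int p_n v dnu = \int f X^n v(Y) dP] for all square integrable [v].  If
    both regressions have full order, the matrix of the inner products of [f]
    with [alpha_i(X) beta_j(Y)] vanishes below and above the diagonal and has
    no zero on it.  The residues [r_N] of the diagonal expansion are bounded
    and eventually orthogonal to every polynomial in [(x, y)]; as polynomials
    are dense, [<r_N, f>], which is [|r_N|^2], tends to 0.  Conversely a
    diagonal expansion gives [p_n] by expanding [X^n] along the [alpha_k].

    Density uses only the exponential moments.  A linear space of functions
    stable under square-integrably dominated limits which contains the
    polynomials contains [cos(t x + c)], going from [t] to [t + h] for small [h]
    through the power series of [cos(h x)] and [sin(h x)]; hence polynomials in
    [sin(w x + b)], hence the indicator of [sin(w x + b) > 0], hence, letting
    [w] tend to 0, the indicators of rays. *)

(** * Square integrable functions *)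

(** Plain functions rather than classes modulo null sets, so that pointwise limits and composition
    with [X] and [Y] make sense. *)
Definition L2 d (T : measurableType d) (R : realType) (P : probability T R)
    (f : T -> R) : Prop :=
  measurable_fun setT f /\ P.-integrable setT (fun x => (f x ^+ 2)%:E).

Definition dot d (T : measurableType d) (R : realType) (P : probability T R)
    (f g : T -> R) : R := (\int[P]_x (f x * g x))%R.

Section L2_theory.
Context d (T : measurableType d) (R : realType) (P : probability T R).
Implicit Types f g h : T -> R.

Lemma integrable_le f g : measurable_fun setT f ->
  P.-integrable setT (EFin \o g) -> (forall x, `|f x| <= g x) ->
  P.-integrable setT (EFin \o f).
Proof.
move=> mf ig fg; apply: (le_integrable measurableT _ _ ig) => /=.
  exact/measurable_EFinP.
by move=> x _ /=; rewrite lee_fin (le_trans (fg x))// ler_norm.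
Qed.

Lemma L2_measurable f : L2 P f -> measurable_fun setT f. Proof. by case. Qed.

Lemma integrable_cst (r : R) : P.-integrable setT (fun x => r%:E).
Proof. exact: finite_measure_integrable_cst. Qed.

Lemma integrableD_EFin f g : P.-integrable setT (EFin \o f) ->
  P.-integrable setT (EFin \o g) ->
  P.-integrable setT (EFin \o (fun x => f x + g x)).
Proof.
move=> fi gi; have := integrableD measurableT fi gi.
by apply: eq_integrable.
Qed.

Lemma integrableZ_EFin f (a : R) : P.-integrable setT (EFin \o f) ->
  P.-integrable setT (EFin \o (fun x => a * f x)).
Proof.
move=> fi; have := integrableZl measurableT a fi.
by apply: eq_integrable.
Qed.

Lemma L2_le f g : measurable_fun setT f -> L2 P g ->
  (forall x, `|f x| <= `|g x|) -> L2 P f.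
Proof.
move=> mf [mg ig] fg; split => //.
apply: (integrable_le (g := fun x => g x ^+ 2)) => //.
  by apply: measurable_funX.
move=> x; rewrite ger0_norm ?sqr_ge0// -(real_normK (num_real (f x))).
by rewrite -(real_normK (num_real (g x))) lerXn2r// nnegrE.
Qed.

(** By |f g| <= f^2 + g^2. *)
Lemma L2_integrableM f g : L2 P f -> L2 P g ->
  P.-integrable setT (EFin \o (fun x => f x * g x)).
Proof.
move=> [mf fi] [mg gi].
apply: (integrable_le _ (integrableD_EFin fi gi)).
  exact: measurable_funM.
move=> x /=; rewrite normrM.
rewrite -(real_normK (num_real (f x))) -(real_normK (num_real (g x))).
by move: `|f x| `|g x| => a b; nra.
Qed.

Lemma L2_cst (r : R) : L2 P (fun=> r).
Proof. by split; [exact: measurable_cst|exact: integrable_cst]. Qed.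

Lemma L2_bounded f (M : R) : measurable_fun setT f ->
  (forall x, `|f x| <= M) -> L2 P f.
Proof.
move=> mf fM; apply: (L2_le mf (L2_cst M)) => x.
by rewrite (le_trans (fM x))// ler_norm.
Qed.

Lemma L2_integrable f : L2 P f -> P.-integrable setT (EFin \o f).
Proof.
move=> fL; have := L2_integrableM fL (L2_cst 1).
by congr (integrable _ _ _); apply/funext => x /=; rewrite mulr1.
Qed.

Lemma L2_norm f : L2 P f -> L2 P (fun x => `|f x|).
Proof.
move=> fL; apply: (L2_le _ fL) => [|x]; last by rewrite normr_id.
exact: (measurableT_comp _ fL.1).
Qed.

Lemma L2_indic (A : set T) : measurable A -> L2 P (\1_A).
Proof.
move=> mA; apply: (@L2_bounded _ 1); first exact: measurable_indic.
by move=> x; rewrite indicE; case: (x \in A); rewrite ?normr1 ?normr0.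
Qed.

Lemma L2_lin (a : R) f g : L2 P f -> L2 P g -> L2 P (fun x => a * f x + g x).
Proof.
move=> fL gL; have [mf fi] := fL; have [mg gi] := gL.
split; first by apply: measurable_funD => //; exact: measurable_funM.
apply: (@eq_integrable _ _ _ P _ measurableT (EFin \o (fun x =>
  a ^+ 2 * f x ^+ 2 + (2 * a * (f x * g x) + g x ^+ 2)))).
  by move=> x _ /=; congr (_%:E); ring.
apply: integrableD_EFin; first exact: integrableZ_EFin.
by apply: integrableD_EFin => //; apply: integrableZ_EFin; exact: L2_integrableM.
Qed.

Lemma L2Z (a : R) f : L2 P f -> L2 P (fun x => a * f x).
Proof.
move=> fL; have := L2_lin a fL (L2_cst 0).
by under eq_fun do rewrite addr0.
Qed.

Lemma L2D f g : L2 P f -> L2 P g -> L2 P (fun x => f x + g x).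
Proof.
move=> fL gL; have := L2_lin 1 fL gL.
by under eq_fun do rewrite mul1r.
Qed.

Lemma L2B f g : L2 P f -> L2 P g -> L2 P (fun x => f x - g x).
Proof.
move=> fL gL; have := L2_lin (-1) gL fL.
by under eq_fun do rewrite mulN1r addrC.
Qed.

Lemma L2_sum (I : Type) (s : seq I) (F : I -> T -> R) :
  (forall i, L2 P (F i)) -> L2 P (fun x => \sum_(i <- s) F i x).
Proof.
move=> FL; elim: s => [|i s ih].
  by under eq_fun do rewrite big_nil; exact: L2_cst.
by under eq_fun do rewrite big_cons; exact: L2D.
Qed.

Lemma eq_dot f f' g g' : f =1 f' -> g =1 g' -> dot P f g = dot P f' g'.
Proof. by move=> /funext -> /funext ->. Qed.

Lemma dotC f g : dot P f g = dot P g f.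
Proof. by apply: eq_Rintegral => x _; rewrite mulrC. Qed.

Lemma dot_linl (a : R) f g h : L2 P f -> L2 P g -> L2 P h ->
  dot P (fun x => a * f x + g x) h = a * dot P f h + dot P g h.
Proof.
move=> fL gL hL; have fh := L2_integrableM fL hL; have gh := L2_integrableM gL hL.
rewrite /dot -RintegralZl// -RintegralD//; last exact: integrableZ_EFin.
by apply: eq_Rintegral => x _; ring.
Qed.

Lemma dot_linr (a : R) f g h : L2 P f -> L2 P g -> L2 P h ->
  dot P h (fun x => a * f x + g x) = a * dot P h f + dot P h g.
Proof. by move=> fL gL hL; rewrite dotC dot_linl// ![dot _ h _]dotC. Qed.

Lemma dotDl f g h : L2 P f -> L2 P g -> L2 P h ->
  dot P (fun x => f x + g x) h = dot P f h + dot P g h.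
Proof.
move=> fL gL hL; rewrite -[in RHS](mul1r (dot P f h)) -dot_linl//.
by apply: eq_dot => // x; rewrite mul1r.
Qed.

Lemma dotBl f g h : L2 P f -> L2 P g -> L2 P h ->
  dot P (fun x => f x - g x) h = dot P f h - dot P g h.
Proof.
move=> fL gL hL; rewrite [RHS]addrC -mulN1r -dot_linl//.
by apply: eq_dot => // x; rewrite mulN1r addrC.
Qed.

Lemma dotZl (a : R) f h : L2 P f -> L2 P h ->
  dot P (fun x => a * f x) h = a * dot P f h.
Proof.
move=> fL hL; rewrite /dot -RintegralZl//; last exact: L2_integrableM.
by apply: eq_Rintegral => x _; rewrite mulrA.
Qed.

Lemma dot0l h : dot P (fun=> 0) h = 0.
Proof.
rewrite /dot; under eq_Rintegral do rewrite mul0r.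
by rewrite Rintegral_cst// mul0r.
Qed.

Lemma dot_suml (I : eqType) (s : seq I) (F : I -> T -> R) h :
  (forall i, L2 P (F i)) -> L2 P h ->
  dot P (fun x => \sum_(i <- s) F i x) h = \sum_(i <- s) dot P (F i) h.
Proof.
move=> FL hL; elim: s => [|i s ih].
  by rewrite big_nil -[RHS](dot0l h); apply: eq_dot => // x; rewrite big_nil.
rewrite big_cons -ih -dotDl//; last exact: L2_sum.
by apply: eq_dot => // x; rewrite big_cons.
Qed.

Lemma dot_ge0 f : 0 <= dot P f f.
Proof. by apply: Rintegral_ge0 => x _; rewrite -expr2 sqr_ge0. Qed.

Lemma dotBB f g : L2 P f -> L2 P g ->
  dot P (fun x => f x - g x) (fun x => f x - g x) =
  dot P f f - 2 * dot P f g + dot P g g.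
Proof.
move=> fL gL; have fgL := L2B fL gL.
rewrite dotBl// ![dot _ _ (fun x => _ - _)]dotC !dotBl// (dotC g f); ring.
Qed.

(** Takes the place of the Cauchy-Schwarz inequality, the weight [e] being free at each use. Expand
    e |f - (a / e) g|^2 >= 0 with a = 1 and a = -1. *)
Lemma dot_young (e : R) f g : 0 < e -> L2 P f -> L2 P g ->
  2 * `|dot P f g| <= e * dot P f f + e^-1 * dot P g g.
Proof.
move=> e0 fL gL.
have H (a : R) : a ^+ 2 = 1 ->
    2 * (a * dot P f g) <= e * dot P f f + e^-1 * dot P g g.
  move=> a1; rewrite -subr_ge0.
  have -> : e * dot P f f + e^-1 * dot P g g - 2 * (a * dot P f g) =
     e * dot P (fun x => f x - (a / e) * g x) (fun x => f x - (a / e) * g x).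
    have gL' := L2Z (a / e) gL.
    rewrite dotBB// dotZl// ![dot _ _ (fun x => _ * _)]dotC !dotZl//.
    rewrite (dotC g f) (_ : a / e * (a / e * dot P g g) = a ^+ 2 * (e^-1 ^+ 2 * dot P g g));
      last by ring.
    rewrite a1; field; exact: lt0r_neq0.
  by rewrite mulr_ge0 ?dot_ge0// ltW.
have [_|_] := ler0P (dot P f g).
  by have := H (-1); rewrite mulN1r sqrrN expr1n; exact.
by have := H 1; rewrite mul1r expr1n; exact.
Qed.

Lemma Rintegral_cvg (f_ : nat -> T -> R) f g :
  (forall n, measurable_fun setT (f_ n)) -> measurable_fun setT f ->
  (forall x, f_ ^~ x @ \oo --> f x) -> P.-integrable setT (EFin \o g) ->
  (forall n x, `|f_ n x| <= g x) ->
  (\int[P]_x f_ n x)%R @[n --> \oo] --> (\int[P]_x f x)%R.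
Proof.
move=> mf_ mf f_f ig f_g.
have [] := @dominated_convergence _ _ _ P setT measurableT
  (fun n x => (f_ n x)%:E) (fun x => (f x)%:E) (EFin \o g).
- by move=> n; exact/measurable_EFinP.
- exact/measurable_EFinP.
- apply: aeW => x _; apply: cvg_EFin; last exact: f_f.
  by apply: nearW => n.
- exact: ig.
- by apply: aeW => x n _; rewrite lee_fin.
move=> fi _ cv; apply: fine_cvg; rewrite fineK//; exact: integrable_fin_num.
Qed.

Lemma dot_cvgr (f_ : nat -> T -> R) f g r :
  (forall n, measurable_fun setT (f_ n)) -> measurable_fun setT f ->
  (forall x, f_ ^~ x @ \oo --> f x) -> L2 P g -> L2 P r ->
  (forall n x, `|f_ n x| <= g x) ->
  dot P r (f_ n) @[n --> \oo] --> dot P r f.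
Proof.
move=> mf_ mf f_f gL rL f_g; have mr := L2_measurable rL.
have nrL := L2_norm rL.
apply: (Rintegral_cvg (g := fun x => `|r x| * g x)).
- by move=> n; exact: measurable_funM.
- exact: measurable_funM.
- by move=> x; apply: cvgMr.
- exact: L2_integrableM.
- by move=> n x; rewrite normrM ler_wpM2l.
Qed.

Lemma dot_cvgB (f_ : nat -> T -> R) f g :
  (forall n, measurable_fun setT (f_ n)) -> measurable_fun setT f ->
  (forall x, f_ ^~ x @ \oo --> f x) -> L2 P g ->
  (forall n x, `|f_ n x| <= g x) ->
  dot P (fun x => f_ n x - f x) (fun x => f_ n x - f x) @[n --> \oo] --> (0 : R).
Proof.
move=> mf_ mf f_f gL f_g; have [mg gi] := gL.
have fg x : `|f x| <= g x.
  apply: (cvgr_to_le (cvg_norm (f_f x))).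
  by near=> n; exact: f_g.
rewrite -[X in _ --> X](dot0l (fun=> 0)).
(* The limit inherits the bound [g], so |f_n - f| <= 2 g. *)
apply: (Rintegral_cvg (g := fun x => 4 * g x ^+ 2)).
- by move=> n; apply: measurable_funM; exact: measurable_funB.
- by apply: measurable_funM; exact: measurable_cst.
- by move=> x; apply: cvgM; rewrite -(subrr (f x)); apply: cvgB => //; exact: cvg_cst.
- exact: integrableZ_EFin.
- move=> n x; rewrite normrM -expr2.
  have : `|f_ n x - f x| <= 2 * g x.
    rewrite (le_trans (ler_normB _ _))//.
    by rewrite mulr2n mulrDl !mul1r lerD.
  by move=> h; have := normr_ge0 (f_ n x - f x); nra.
Unshelve. all: by end_near.
Qed.

End L2_theory.

(** * Spaces stable under dominated limits *)

(** The induction principle of the density arguments. Closure is asked for dominated pointwise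
    limits instead of limits in norm, because the approximations used below (power series, iterates,
    simple functions) converge pointwise. *)
Definition dominated_closed d (T : measurableType d) (R : realType)
    (P : probability T R) (K : set (T -> R)) : Prop :=
  (forall (a : R) f g, K f -> K g -> K (fun x => a * f x + g x)) /\
  (forall (f_ : nat -> T -> R) f g, (forall n, K (f_ n)) -> L2 P g ->
     (forall n x, `|f_ n x| <= g x) -> (forall x, f_ ^~ x @ \oo --> f x) -> K f).

Lemma dominated_closed_eq (T T' : Type) (K : set (T -> T')) (f g : T -> T') :
  f =1 g -> K f -> K g.
Proof. by move=> /funext ->. Qed.

Section dominated_closed_theory.
Context d (T : measurableType d) (R : realType) (P : probability T R).
Variable K : set (T -> R).
Hypothesis Kcl : dominated_closed P K.
Implicit Types f g : T -> R.

Lemma dominated_closed_lin (a : R) f g :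
  K f -> K g -> K (fun x => a * f x + g x).
Proof. exact: Kcl.1. Qed.

Lemma dominated_closed_lim (f_ : nat -> T -> R) f g :
  (forall n, K (f_ n)) -> L2 P g -> (forall n x, `|f_ n x| <= g x) ->
  (forall x, f_ ^~ x @ \oo --> f x) -> K f.
Proof. exact: Kcl.2. Qed.

(** [K] may be empty, so the zero function has to come from some member. *)
Lemma dominated_closed0 f : K f -> K (fun=> 0).
Proof.
move=> Kf; apply: dominated_closed_eq (dominated_closed_lin (-1) Kf Kf) => x.
by rewrite mulN1r addNr.
Qed.

Lemma dominated_closedD f g : K f -> K g -> K (fun x => f x + g x).
Proof.
move=> Kf Kg; apply: dominated_closed_eq (dominated_closed_lin 1 Kf Kg) => x.
by rewrite mul1r.
Qed.

Lemma dominated_closedB f g : K f -> K g -> K (fun x => f x - g x).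
Proof.
move=> Kf Kg; apply: dominated_closed_eq (dominated_closed_lin (-1) Kg Kf) => x.
by rewrite mulN1r addrC.
Qed.

Lemma dominated_closedZ (a : R) f : K f -> K (fun x => a * f x).
Proof.
move=> Kf.
apply: dominated_closed_eq (dominated_closed_lin a Kf (dominated_closed0 Kf)) => x.
by rewrite addr0.
Qed.

Lemma dominated_closed_sum (I : Type) (s : seq I) (F : I -> T -> R) :
  K (fun=> 0) -> (forall i, K (F i)) -> K (fun x => \sum_(i <- s) F i x).
Proof.
move=> K0 KF; elim: s => [|i s ih].
  by apply: dominated_closed_eq K0 => x; rewrite big_nil.
by apply: dominated_closed_eq (dominated_closedD (KF i) ih) => x; rewrite big_cons.
Qed.

Import HBSimple HBNNSimple.

(** Simple functions increase to [f], which is itself their square integrable majorant. *)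
Lemma dominated_closed_indic_ge0 : (forall A, measurable A -> K \1_A) ->
  forall f, (forall x, 0 <= f x) -> L2 P f -> K f.
Proof.
move=> KA f f0 fL; have [mf _] := fL.
have mfE : measurable_fun setT (EFin \o f) by exact/measurable_EFinP.
pose g := nnsfun_approx measurableT mfE.
have f0E x : setT x -> (0 <= (EFin \o f) x)%E by rewrite lee_fin.
have gf x : EFin \o g ^~ x @ \oo --> (EFin \o f) x.
  exact: cvg_nnsfun_approx.
have {}gf x : g ^~ x @ \oo --> f x.
  exact: (fine_cvg (gf x)).
have K0 : K (fun=> 0).
  by apply: dominated_closed_eq (KA set0 measurable0) => x; rewrite indic0.
apply: (dominated_closed_lim (f_ := fun n => g n : T -> R) (g := f)) => //.
(* A simple function is the sum, over its finitely many values, of value times indicator of the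
   level set; [undup] makes each value occur once. *)
- move=> n; have /finite_seqP[s sE] : finite_set (range (g n)).
    exact: fimfunP.
  apply: (@dominated_closed_eq _ _ _
    (fun x => \sum_(y <- undup s) y * \1_(g n @^-1` [set y]) x)).
    move=> x; rewrite [RHS](fimfunE (g n)) (fsbig_seq _ _ (undup_uniq s))//.
    apply: eq_fsbigl; rewrite sE; apply/seteqP; split => y /=;
    by rewrite mem_undup.
  apply: dominated_closed_sum => // y; apply: dominated_closedZ; apply: KA.
  exact: measurable_sfunP.
- move=> n x; rewrite ger0_norm//.
  by have := le_approx n f0E (I : setT x); rewrite -nnsfun_approxE lee_fin.
Qed.

(** Positive and negative part are both bounded by |f|. *)
Lemma dominated_closed_indic : (forall A, measurable A -> K \1_A) ->
  forall f, L2 P f -> K f.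
Proof.
move=> KA f fL; have [mf _] := fL.
apply: (@dominated_closed_eq _ _ _ (fun x => Num.max (f x) 0 - Num.max (- f x) 0)).
  by move=> x; case: (lerP (f x) 0) => h; case: (lerP (- f x) 0) => h'; lra.
have absmax (a : R) : `|Num.max a 0| <= `|a|.
  by case: (lerP a 0) => // _; rewrite normr0.
apply: dominated_closedB; apply: (dominated_closed_indic_ge0 KA).
- by move=> x; rewrite le_max lexx orbT.
- by apply: (L2_le _ fL) => //; exact: measurable_maxr.
- by move=> x; rewrite le_max lexx orbT.
- apply: (L2_le _ fL) => //; first by apply: measurable_maxr => //; exact: measurable_funN.
  by move=> x; rewrite -[leRHS]normrN.
Qed.

(** The sets with indicator in [K] form a Dynkin system: complements by subtraction from 1, disjoint
    unions as limits bounded by 1. The pi-lambda theorem then reaches all measurable sets. *)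
Lemma dominated_closed_generated (G : set (set T)) :
  @measurable _ T = <<s G >> -> setI_closed G ->
  K (fun=> 1) -> (forall A, G A -> K \1_A) ->
  forall f, L2 P f -> K f.
Proof.
move=> mG GI K1 KG; apply: dominated_closed_indic => A mA.
have K0 := dominated_closed0 K1.
rewrite mG in mA; move: A mA.
apply: (@dynkin_induction _ T G (fun A => K \1_A) mG GI).
- by apply: dominated_closed_eq K1 => x; rewrite indicT.
- exact: KG.
- move=> S mS KS; apply: dominated_closed_eq (dominated_closedB K1 KS) => x.
  by rewrite !indicE in_setC; case: (x \in S) => /=; rewrite ?subrr ?subr0.
move=> F mF tF KF.
have indic_le1 (A : set T) x : `|\1_A x : R| <= 1.
  by rewrite indicE; case: (x \in A); rewrite ?normr1 ?normr0.
apply: (dominated_closed_lim (g := fun=> 1)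
  (f_ := fun n => \1_(\big[setU/set0]_(i < n) F i))) => //.
- elim=> [|n ih].
    by rewrite big_ord0; apply: dominated_closed_eq K0 => x; rewrite indic0.
  rewrite big_ord_recr/=.
  apply: dominated_closed_eq (dominated_closedD ih (KF n)) => x.
  rewrite !indicE in_setU; have [xF|//] := boolP (x \in F n); last first.
    by rewrite orbF addr0.
  (* By disjointness a point of [F n] lies in no earlier [F i], so the indicators add up. *)
  suff -> : (x \in \big[setU/set0]_(i < n) F i) = false by rewrite add0r.
  apply/negbTE/negP; rewrite inE -bigcup_mkord => -[k /= kn Fkx].
  have := tF k n I I; rewrite inE in xF.
  by move=> /(_ (ex_intro _ x (conj Fkx xF))) kE; rewrite kE ltnn in kn.
- exact: L2_cst.
- move=> x; have [[k _ Fkx]|nF] := pselect ((\bigcup_k F k) x).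
    apply: cvg_near_cst; exists k.+1 => // n /= kn.
    rewrite !indicE !mem_set//; first by exists k.
    by rewrite -bigcup_mkord; exists k.
  apply: cvg_near_cst; apply: nearW => n.
  rewrite !indicE !memNset// -bigcup_mkord => -[k _ Fkx].
  by apply: nF; exists k.
Qed.

End dominated_closed_theory.

(** * Density of polynomials under exponential moments *)

(** The quotient of y^n by n! is one term of the exponential series, whose terms are all
    nonnegative. *)
Lemma exprn_le_expR (R : realType) (y : R) n : 0 <= y -> y ^+ n <= n`!%:R * expR y.
Proof.
move=> y0; case: n => [|n].
  by rewrite expr0 mul1r (le_trans _ (expR_ge1Dx y))// lerDl.
rewrite -ler_pdivrMl ?ltr0n ?fact_gt0// mulrC.
by rewrite (le_trans _ (expR_ge1Dxn n y0))// lerDr.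
Qed.

(** * Polynomial approximation of the sign *)

Section sgr_poly.
Variable R : realType.

(* The iterates of [s |-> (3 s - s^3) / 2], which tend to the sign of [s] on
   [[-1, 1]]. *)
Fixpoint sgr_poly n : {poly R} :=
  if n is n'.+1 then (3 / 2) *: sgr_poly n' - 2^-1 *: sgr_poly n' ^+ 3 else 'X.

Lemma sgr_polyS n (s : R) : (sgr_poly n.+1).[s] =
  3 / 2 * (sgr_poly n).[s] - 2^-1 * (sgr_poly n).[s] ^+ 3.
Proof. by rewrite /= !hornerE. Qed.

Lemma sgr_polyN n (s : R) : (sgr_poly n).[- s] = - (sgr_poly n).[s].
Proof.
elim: n => [|n ih]; first by rewrite /= !hornerE.
by rewrite !sgr_polyS ih; ring.
Qed.

(** The points -1 and 1 are fixed by the iteration and critical for it; hence the square factors in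
    the two differences. *)
Lemma sgr_poly_le1 n (s : R) : `|s| <= 1 -> `|(sgr_poly n).[s]| <= 1.
Proof.
move=> s1; elim: n => [|n]; first by rewrite /= hornerX.
rewrite sgr_polyS; move: (_.[s]) => u; rewrite !ler_norml => /andP[u1 u2].
apply/andP; split; rewrite -subr_ge0.
  rewrite (_ : _ - _ = (1 + u) ^+ 2 * (2 - u) / 2); last by field.
  by rewrite divr_ge0// mulr_ge0 ?sqr_ge0//; lra.
rewrite (_ : _ - _ = (1 - u) ^+ 2 * (2 + u) / 2); last by field.
by rewrite divr_ge0// mulr_ge0 ?sqr_ge0//; lra.
Qed.

(** On (0, 1] the iterates do not decrease, hence stay above [s], and each step multiplies the gap
    to 1 by at most 1 - s / 2. *)
Lemma sgr_poly_gt0 n (s : R) : 0 < s <= 1 ->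
  s <= (sgr_poly n).[s] /\ 1 - (sgr_poly n).[s] <= (1 - s / 2) ^+ n.
Proof.
move=> /andP[s0 s1]; elim: n => [|n].
  by rewrite /= hornerX expr0; split; lra.
have := @sgr_poly_le1 n s; rewrite ger0_norm ?(ltW s0)// => /(_ s1).
rewrite sgr_polyS (exprS _ n); move: (_.[s]) => u u1 [su uE].
have {}u1 : u <= 1 by rewrite (le_trans _ u1)// ler_norm.
split.
  rewrite (le_trans su)// -subr_ge0.
  rewrite (_ : _ - _ = u * (1 - u) * (1 + u) / 2); last by field.
  by rewrite divr_ge0// !mulr_ge0//; lra.
apply: (@le_trans _ _ ((1 - s / 2) * (1 - u))); last by rewrite ler_wpM2l//; lra.
rewrite -subr_ge0 (_ : _ - _ = (1 - u) * ((u - s) + u ^+ 2) / 2); last by field.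
by rewrite divr_ge0// mulr_ge0//; [lra|rewrite addr_ge0 ?sqr_ge0//; lra].
Qed.

(** Squeezed by the geometric bound for s > 0; the case s < 0 follows by oddness, and 0 is a fixed
    point. *)
Lemma cvg_sgr_poly (s : R) : `|s| <= 1 ->
  (fun n => (sgr_poly n).[s]) @ \oo --> Num.sg s.
Proof.
have gt0 (x : R) : 0 < x <= 1 -> (fun n => (sgr_poly n).[x]) @ \oo --> (1 : R).
  move=> x01; have /andP[x0 x1] := x01.
  apply: (@squeeze_cvgr _ _ _ _ (fun n => 1 - (1 - x / 2) ^+ n) (fun=> 1)).
  - apply: nearW => n; have [_ h] := sgr_poly_gt0 n x01.
    have := @sgr_poly_le1 n x; rewrite (ger0_norm (ltW x0)) => /(_ x1).
    by rewrite ler_norml => /andP[_ ->]; rewrite andbT; lra.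
  - rewrite -[X in _ --> X]subr0; apply: cvgB; first exact: cvg_cst.
    by apply: cvg_expr; rewrite ger0_norm; lra.
  - exact: cvg_cst.
move=> s1; have [s0|s0|->] := ltrgt0P s.
- rewrite gtr0_sg//; apply: gt0; rewrite s0/=.
  by rewrite (le_trans _ s1)// ler_norm.
- rewrite ltr0_sg//.
  have -> : (fun n => (sgr_poly n).[s]) = (fun n => - (sgr_poly n).[- s]).
    by apply/funext => n; rewrite sgr_polyN opprK.
  apply: cvgN; apply: gt0; rewrite oppr_gt0 s0/=.
  by rewrite (le_trans _ s1)// -normrN ler_norm.
- rewrite sgr0; have -> : (fun n => (sgr_poly n).[0]) = (fun n => 0 : R).
    apply/funext => n; elim: n => [|n ih]; first by rewrite /= hornerX.
    by rewrite sgr_polyS ih; ring.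
  exact: cvg_cst.
Qed.

End sgr_poly.
Arguments sgr_poly {R} n.

(** * From powers to all square integrable functions on the line *)

Section exponential_moment.
Variables (R : realType) (mu : probability (measurableTypeR R) R) (delta : R).
Hypothesis delta0 : 0 < delta.
Hypothesis mu_exp :
  mu.-integrable setT (fun x : measurableTypeR R => (expR (delta * `|x : R|))%:E).

(** After squaring, one half of the exponent [delta] absorbs the power |x|^(2k), and the other half
    covers 2 |h| <= delta / 2. *)
Lemma L2_exprn_expR k (h : R) : `|h| <= delta / 4 ->
  L2 mu (fun x : measurableTypeR R => `|x : R| ^+ k * expR (`|h| * `|x : R|)).
Proof.
move=> hd; have mn : measurable_fun setT (fun x : measurableTypeR R => `|x : R|).
  exact: normr_measurable.
have mG : measurable_fun setT
    (fun x : measurableTypeR R => `|x : R| ^+ k * expR (`|h| * `|x : R|)).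
  apply: measurable_funM; first exact: measurable_funX.
  by apply: measurableT_comp => //; apply: measurable_funM.
split => //.
(* From y^(2k) <= (2k)! exp(y) at y = (delta / 2) |x|. *)
pose C : R := (delta / 2)^-1 ^+ (k * 2) * (k * 2)`!%:R.
apply: (integrable_le (g := fun x : measurableTypeR R => C * expR (delta * `|x : R|))).
- exact: measurable_funX.
- exact: integrableZ_EFin.
move=> x; rewrite ger0_norm ?sqr_ge0// exprMn -exprM.
have x0 : 0 <= `|x : R| := normr_ge0 _.
set a := `|(x : R)| in x0 *.
have d2 : 0 < delta / 2 by rewrite divr_gt0.
have -> : a ^+ (k * 2) = (delta / 2)^-1 ^+ (k * 2) * ((delta / 2) * a) ^+ (k * 2).
  by rewrite exprMn mulrA -exprMn mulVf ?gt_eqF// expr1n mul1r.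
rewrite /C; set q := (delta / 2)^-1 ^+ (k * 2).
have q0 : 0 < q by rewrite exprn_gt0// invr_gt0.
rewrite -(mulrA q) -(mulrA q) ler_pM2l//.
have -> : expR (delta * a) = expR (delta / 2 * a) * expR (delta / 2 * a).
  by rewrite -expRD; congr expR; lra.
have da0 : 0 <= delta / 2 * a by rewrite mulr_ge0// ltW.
rewrite [leRHS]mulrA ler_pM ?exprn_ge0 ?expR_ge0//.
- exact: exprn_le_expR.
- rewrite -expRM_natl ler_expR.
  by move: `|h| hd => b hd; nra.
Qed.

Lemma L2_exprn k : L2 mu (fun x : measurableTypeR R => (x : R) ^+ k).
Proof.
apply: (L2_le _ (L2_exprn_expR k (h := 0) _)).
- exact: measurable_funX.
- by rewrite normr0 divr_ge0// ltW.
- move=> x; rewrite normr0 mul0r expR0 mulr1 !normrX normr_id//.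
Qed.

Variable K : set (measurableTypeR R -> R).
Hypothesis Kcl : dominated_closed mu K.
Hypothesis Kpow : forall k, K (fun x => (x : R) ^+ k).

(** The partial sums are combinations of x^(k+i) theta(x). Since |a i| <= 1 / i!, they are bounded
    by |x|^k exp(|h| |x|), which is square integrable for small [h]. The lemma is used with the
    coefficients of cosine and of sine. *)
Lemma dominated_closed_series (a : nat -> R) (phi theta : R -> R) (h : R) :
  (forall i, `|a i| <= i`!%:R^-1) ->
  (forall y, series (fun i => a i * y ^+ i) @ \oo --> phi y) ->
  (forall x, `|theta x| <= 1) -> `|h| <= delta / 4 ->
  (forall k, K (fun x => (x : R) ^+ k * theta x)) ->
  forall k, K (fun x => (x : R) ^+ k * (theta x * phi (h * x))).
Proof.
move=> aE aphi theta1 hd Kth k.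
apply: (dominated_closed_lim Kcl
  (f_ := fun n x => (x : R) ^+ k * (theta x * series (fun i => a i * (h * x) ^+ i) n))
  (g := fun x => `|x : R| ^+ k * expR (`|h| * `|x : R|))).
- move=> n; apply: (@dominated_closed_eq _ _ _ (fun x : measurableTypeR R =>
    \sum_(i <- index_iota 0 n) a i * h ^+ i * ((x : R) ^+ (k + i) * theta x))).
    move=> x; rewrite /series/= mulr_sumr mulr_sumr; apply: eq_bigr => i _.
    by rewrite exprD exprMn; ring.
  apply: (dominated_closed_sum Kcl) => [|i].
    exact: dominated_closed0 Kcl _ (Kpow 0).
  exact: (dominated_closedZ Kcl).
- exact: L2_exprn_expR.
- move=> n x; rewrite normrM normrX ler_wpM2l ?exprn_ge0// normrM.
  rewrite -[leRHS]mul1r ler_pM//.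
  rewrite -normrM.
  apply: (@le_trans _ _ (series (exp_coeff `|h * x|) n)).
    rewrite /series/= (le_trans (ler_norm_sum _ _ _))// ler_sum// => i _.
    by rewrite /exp_coeff/= normrM mulrC normrX ler_wpM2l ?exprn_ge0.
  rewrite /expR; apply: nondecreasing_cvgn_le; last exact: is_cvg_series_exp_coeff.
  by apply: nondecreasing_series => i _ _; exact: exp_coeff_ge0.
- by move=> x; apply: cvgMr; apply: cvgMr; exact: aphi.
Qed.

(** Induction on [m] by the addition theorem for cos(m h x + c + h x), expanding cos(h x) and sin(h
    x). The factor sin(m h x + c) is a cosine of phase c - pi / 2, so the phase has to vary in the
    induction. *)
Lemma dominated_closed_cos_small m (h : R) : `|h| <= delta / 4 ->
  forall (c : R) k, K (fun x => (x : R) ^+ k * cos (m%:R * h * x + c)).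
Proof.
move=> hd; elim: m => [|m ih] c k.
  apply: dominated_closed_eq (dominated_closedZ Kcl (cos c) (Kpow k)) => x.
  by rewrite !mul0r add0r mulrC.
have th1 c' (x : R) : `|cos (m%:R * h * x + c')| <= 1 by exact: cos_max.
have sE x : sin (m%:R * h * x + c) = cos (m%:R * h * x + (c - pi / 2)).
  by rewrite addrA cosBpihalf.
have K1 := dominated_closed_series (a := fun n => (~~ odd n)%:R * (-1) ^+ n./2 * n`!%:R^-1)
  (phi := cos) _ _ (th1 c) hd (ih c) k.
have K2 := dominated_closed_series (a := fun n => (odd n)%:R * (-1) ^+ n.-1./2 * n`!%:R^-1)
  (phi := sin) _ _ (th1 (c - pi / 2)) hd (ih _) k.
apply: dominated_closed_eq (dominated_closedB Kcl (K1 _ _) (K2 _ _)).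
- move=> x; rewrite -sE -mulrBr -cosD; congr (_ * cos _).
  by rewrite -natr1; ring.
- move=> i; rewrite !normrM normrX normrN1 expr1n mulr1 normr_nat normfV normr_nat.
  by case: odd; rewrite ?mul1r ?mul0r ?invr_ge0.
- by move=> y; rewrite -cos_coeffE unlock; exact: is_cvg_series_cos_coeff.
- move=> i; rewrite !normrM normrX normrN1 expr1n mulr1 normr_nat normfV normr_nat.
  by case: odd; rewrite ?mul1r ?mul0r ?invr_ge0.
- by move=> y; rewrite -sin_coeffE unlock; exact: is_cvg_series_sin_coeff.
Qed.

Lemma dominated_closed_cos (t c : R) : K (fun x => cos (t * x + c)).
Proof.
(* Large enough for |t / m| <= delta / 4. *)
pose m := (Num.truncn (`|t| / (delta / 4))).+1.
have m0 : (m%:R : R) != 0 by rewrite pnatr_eq0.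
have := @dominated_closed_cos_small m (t / m%:R) _ c 0%N.
have -> : m%:R * (t / m%:R) = t by rewrite mulrC divfK.
move=> H; apply: dominated_closed_eq (H _); first by move=> x; rewrite mul1r.
have d4 : 0 < delta / 4 by rewrite divr_gt0.
rewrite normrM normfV normr_nat ler_pdivrMr ?ltr0n// -ler_pdivrMl// mulrC.
by rewrite ltW// truncnS_gt.
Qed.

(** Powers of the sine are linearized by product-to-sum formulas. The induction carries a cosine of
    arbitrary frequency and phase, as each formula shifts both; at the end it is taken to be cos 0 =
    1. *)
Lemma dominated_closed_poly_sin (p : {poly R}) (w b : R) :
  K (fun x => p.[sin (w * x + b)]).
Proof.
have Kpc n : forall t c, K (fun x => sin (w * x + b) ^+ n * cos (t * x + c)).
  elim: n => [|n ih] t c.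
    by apply: dominated_closed_eq (dominated_closed_cos t c) => x; rewrite mul1r.
  have H (s d : R) : sin s * cos d = 2^-1 * (cos (d + s - pi / 2) - cos (d - s - pi / 2)).
    by rewrite !cosBpihalf sinD sinB; field.
  apply: dominated_closed_eq (dominated_closedZ Kcl 2^-1 (dominated_closedB Kcl
    (ih (t + w) (c + b - pi / 2)) (ih (t - w) (c - b - pi / 2)))) => x.
  rewrite exprSr -mulrA H -mulrBr mulrCA; congr (_ * (_ * (cos _ - cos _))); ring.
apply: (@dominated_closed_eq _ _ _
    (fun x : measurableTypeR R =>
      \sum_(i < size p) p`_i * (sin (w * x + b) ^+ i * cos (0 * x + 0)))).
  move=> x; rewrite horner_coef; apply: eq_bigr => i _.
  by rewrite mul0r addr0 cos0 mulr1.
apply: (dominated_closed_sum Kcl) => [|i].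
  exact: dominated_closed0 Kcl _ (Kpow 0).
by apply: (dominated_closedZ Kcl); exact: Kpc.
Qed.

(** If v is the sign of s, then (v^2 + v) / 2 is 1 for s > 0 and 0 otherwise; [sgr_poly]
    approximates v boundedly. *)
Lemma dominated_closed_sin_gt0 (w b : R) :
  K (fun x => (0 < sin (w * x + b))%R%:R).
Proof.
apply: (dominated_closed_lim Kcl (g := fun=> 1)
  (f_ := fun n x => 2^-1 * ((sgr_poly n).[sin (w * x + b)] ^+ 2 +
                            (sgr_poly n).[sin (w * x + b)]))).
- move=> n; have := dominated_closed_poly_sin (2^-1 *: (sgr_poly n ^+ 2 + sgr_poly n)) w b.
  by apply: dominated_closed_eq => x; rewrite !hornerE.
- exact: L2_cst.
- move=> n x; have := @sgr_poly_le1 R n _ (sin_max (w * x + b)).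
  move: (_.[_]) => u; rewrite !ler_norml => /andP[u1 u2].
  by apply/andP; split; nra.
- move=> x; have H := cvg_sgr_poly (sin_max (w * x + b)).
  have -> : (0 < sin (w * x + b))%R%:R = 2^-1 * (Num.sg (sin (w * x + b)) ^+ 2 +
      Num.sg (sin (w * x + b))) :> R.
    by case: sgrP => _; rewrite ?expr0n/= ?expr1n ?sqrrN ?expr1n; lra.
  apply: cvgMr; apply: cvgD => //.
  by under eq_fun do rewrite expr2; rewrite expr2; exact: cvgM.
Qed.

(* [sin ((x - a) / n)] has the sign of [x - a] for all large [n]. *)
Lemma dominated_closed_ray (a : R) : K \1_(`]a, +oo[%classic).
Proof.
apply: (dominated_closed_lim Kcl (g := fun=> 1)
  (f_ := fun n x => (0 < sin (n.+1%:R^-1 * (x : R) + n.+1%:R^-1 * - a))%R%:R)).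
- by move=> n; exact: dominated_closed_sin_gt0.
- exact: L2_cst.
- by move=> n x; case: (0 < _); rewrite ?normr1 ?normr0.
- move=> x; apply: cvg_near_cst.
  (* From this index on |x - a| < n + 1, so the argument of the sine stays strictly between -pi and
     pi. *)
  exists (Num.truncn `|(x : R) - a|) => // n /= hn.
  rewrite -mulrDr indicE mem_setE in_itv/= andbT -[in RHS]subr_gt0.
  move: ((x : R) - a) hn => u hn.
  have nu : `|n.+1%:R^-1 * u| < pi.
    rewrite normrM ger0_norm ?invr_ge0// ltr_pdivrMl ?ltr0n//.
    apply: (@lt_le_trans _ _ n.+1%:R).
      by rewrite -truncn_lt_nat ?normr_ge0.
    by rewrite ler_peMr// (le_trans _ (pi_ge2 R))// ler1n.
  congr (nat_of_bool _)%:R; case: (ltrgt0P u) => [u0|u0|->].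
  - apply: sin_gt0_pi; rewrite mulr_gt0 ?invr_gt0//=.
    by rewrite (le_lt_trans _ nu)// ler_norm.
  - apply/negbTE; rewrite -leNgt -oppr_ge0 -sinN; apply: sin_ge0_pi.
    rewrite -mulrN mulr_ge0 ?invr_ge0 ?oppr_ge0 ?(ltW u0)//=.
    by rewrite ltW// (le_lt_trans _ nu)// mulrN -normrN ler_norm.
  - by rewrite mulr0 sin0 ltxx.
Qed.

(** Open right rays generate the Borel sets and are stable under intersection. *)
Theorem dominated_closed_poly_L2 f : L2 mu f -> K f.
Proof.
apply: (dominated_closed_generated Kcl (G := @RGenOInfty.G R)).
- exact: RGenOInfty.measurableE.
- move=> _ _ [a ->] [b ->]; exists (Num.max a b).
  apply/seteqP; split => x /=; rewrite !in_itv/= !andbT gt_max.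
    by move=> [-> ->].
  by move=> /andP[].
- by apply: dominated_closed_eq (Kpow 0).
- by move=> _ [a ->]; exact: dominated_closed_ray.
Qed.

End exponential_moment.

(* The law of [(X, Y)] under [P] is [mu \x nu]; keeping [X] and [Y] abstract allows
   exchanging the two coordinates of the plane. *)
Definition product_law d (T : measurableType d) (R : realType)
    (P : probability T R) (mu nu : probability (measurableTypeR R) R)
    (X Y : T -> R) : Prop :=
  forall u v : R -> R, mu.-integrable setT (EFin \o u) ->
    nu.-integrable setT (EFin \o v) ->
    P.-integrable setT (EFin \o (fun w => u (X w) * v (Y w))) /\
    (\int[P]_w (u (X w) * v (Y w)) = (\int[mu]_x u x) * \int[nu]_y v y)%R.

Section product_law_theory.
Context d (T : measurableType d) (R : realType) (P : probability T R).
Variables (mu nu : probability (measurableTypeR R) R) (X Y : T -> R).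

Lemma product_law_sym : product_law P mu nu X Y -> product_law P nu mu Y X.
Proof.
move=> H u v ui vi; have [H1 H2] := H v u vi ui; split.
  by move: H1; congr (integrable _ _ _); apply/funext => w /=; rewrite mulrC.
by rewrite mulrC -H2; apply: eq_Rintegral => w _; rewrite mulrC.
Qed.

Hypothesis XY : product_law P mu nu X Y.

Lemma L2_tensor (u v : R -> R) : L2 mu u -> L2 nu v ->
  L2 P (fun w => u (X w) * v (Y w)).
Proof.
move=> uL vL.
(* Measurability of the product is read off from the integrability that [XY] grants. *)
have [+ _] := XY (L2_integrable uL) (L2_integrable vL).
move=> /(measurable_int P)/measurable_EFinP mw.
split => //; have [+ _] := XY uL.2 vL.2.
by congr (integrable _ _ _); apply/funext => w /=; rewrite exprMn.
Qed.

Lemma dot_tensor (u v u' v' : R -> R) : L2 mu u -> L2 nu v -> L2 mu u' ->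
  L2 nu v' ->
  dot P (fun w => u (X w) * v (Y w)) (fun w => u' (X w) * v' (Y w)) =
  dot mu u u' * dot nu v v'.
Proof.
move=> uL vL uL' vL'.
have [_ <-] := XY (L2_integrableM uL uL') (L2_integrableM vL vL').
by apply: eq_Rintegral => w _; ring.
Qed.

End product_law_theory.

(** * The product measure and density of polynomials in two variables *)

Section product_plane.
Variables (R : realType) (mu nu : probability (measurableTypeR R) R).
Let P : probability (measurableTypeR R * measurableTypeR R)%type R := (mu \x nu)%E.

Lemma product_law_plane : product_law P mu nu fst snd.
Proof.
move=> u v ui vi.
have mu_ : measurable_fun setT (u : measurableTypeR R -> R).
  by apply/measurable_EFinP; exact: measurable_int ui.
have mv : measurable_fun setT (v : measurableTypeR R -> R).
  by apply/measurable_EFinP; exact: measurable_int vi.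
have muv : measurable_fun setT (EFin \o (fun w : measurableTypeR R * measurableTypeR R =>
    u w.1 * v w.2)).
  apply/measurable_EFinP; apply: measurable_funM.
    exact: (measurableT_comp mu_ measurable_fst).
  exact: (measurableT_comp mv measurable_snd).
have fin (Q : probability (measurableTypeR R) R) (f : R -> R) :
    Q.-integrable setT (EFin \o f) ->
    (\int[Q]_x (f x)%:E = (\int[Q]_x f x)%R%:E)%E.
  by move=> fi; rewrite /Rintegral fineK//; exact: integrable_fin_num fi.
(* Tonelli gives absolute integrability; Fubini then evaluates the integral. *)
have inta : P.-integrable setT (EFin \o (fun w => u w.1 * v w.2)).
  apply/(integrable12ltyP mu nu muv).
  under eq_integral => x _.
    under eq_integral => y _ do rewrite /= normrM EFinM.
    rewrite integralZl//; last exact: (integrable_abse vi).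
    over.
  rewrite /=.
  rewrite (fin nu (fun y => `|v y|)); last exact: (integrable_abse vi).
  under eq_integral do rewrite -EFinM mulrC.
  have := integrableZ_EFin (\int[nu]_y `|v y|)%R
    (integrable_abse ui : mu.-integrable setT (EFin \o (fun x : measurableTypeR R => `|u x|))).
  by move=> h; rewrite (fin mu _ h) ltry.
split => //; rewrite {1}/Rintegral -(integral12_prod_meas1 inta)/fubini_F/=.
under eq_integral => x _.
  under eq_integral => y _ do rewrite EFinM.
  rewrite integralZl// fin// -EFinM mulrC.
  over.
rewrite fin/=; last exact: integrableZ_EFin.
by rewrite RintegralZl// mulrC.
Qed.

Variable delta : R.
Hypothesis delta0 : 0 < delta.
Hypothesis mu_exp :
  mu.-integrable setT (fun x : measurableTypeR R => (expR (delta * `|x : R|))%:E).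
Hypothesis nu_exp :
  nu.-integrable setT (fun x : measurableTypeR R => (expR (delta * `|x : R|))%:E).

Variable K : set (measurableTypeR R * measurableTypeR R -> R).
Hypothesis Kcl : dominated_closed P K.
Hypothesis Kpow : forall i j, K (fun z => (z.1 : R) ^+ i * (z.2 : R) ^+ j).

(** One variable at a time: with y^j fixed the one-variable theorem frees the factor in x, then with
    that factor fixed it frees the one in y. Indicators of rectangles are among the products so
    obtained, and rectangles generate. *)
Theorem dominated_closed_poly2_L2 f : L2 P f -> K f.
Proof.
have K1 j (u : R -> R) : L2 mu u -> K (fun z => u z.1 * (z.2 : R) ^+ j).
  apply: (@dominated_closed_poly_L2 _ mu delta delta0 mu_exp
    [set u | K (fun z => u z.1 * (z.2 : R) ^+ j)]); last by move=> i; exact: Kpow.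
  split=> /= [a g h Kg Kh|g_ g h Kg_ hL g_h g_g].
    apply: dominated_closed_eq (dominated_closed_lin Kcl a Kg Kh) => z /=; ring.
  apply: (dominated_closed_lim Kcl (f_ := fun n z => g_ n z.1 * (z.2 : R) ^+ j)
    (g := fun z => h z.1 * `|(z.2 : R) ^+ j|)).
  - exact: Kg_.
  - apply: (L2_tensor (v := fun y => `|y ^+ j|) product_law_plane hL).
    exact: L2_norm (L2_exprn delta0 nu_exp j).
  - by move=> n z; rewrite normrM ler_wpM2r.
  - by move=> z; apply: cvgMl; exact: g_g.
have K2 (u v : R -> R) : L2 mu u -> L2 nu v -> K (fun z => u z.1 * v z.2).
  move=> uL; apply: (@dominated_closed_poly_L2 _ nu delta delta0 nu_exp
    [set v | K (fun z => u z.1 * v z.2)]); last by move=> i; exact: K1.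
  split=> /= [a g h Kg Kh|g_ g h Kg_ hL g_h g_g].
    apply: dominated_closed_eq (dominated_closed_lin Kcl a Kg Kh) => z /=; ring.
  apply: (dominated_closed_lim Kcl (f_ := fun n z => u z.1 * g_ n z.2)
    (g := fun z => `|u z.1| * h z.2)).
  - exact: Kg_.
  - exact: (L2_tensor (u := fun x => `|u x|) product_law_plane (L2_norm uL) hL).
  - by move=> n z; rewrite normrM ler_wpM2l.
  - by move=> z; apply: cvgMr; exact: g_g.
apply: (dominated_closed_generated Kcl (measurable_prod_measurableType _ _)).
- move=> _ _ [A1 mA1 [A2 mA2 <-]] [B1 mB1 [B2 mB2 <-]].
  exists (A1 `&` B1); first exact: measurableI.
  exists (A2 `&` B2); first exact: measurableI.
  by rewrite setXI.
- by apply: dominated_closed_eq (Kpow 0 0) => z; rewrite mul1r.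
move=> _ [A mA [B mB <-]].
apply: dominated_closed_eq (K2 _ _ (L2_indic mu mA) (L2_indic nu mB)) => z /=.
by rewrite !indicE in_setX -natrM mulnb.
Qed.

End product_plane.

(** * Limits of inner products *)

Section dot_limits.
Context d (T : measurableType d) (R : realType) (P : probability T R).
Implicit Types f g h : T -> R.

Lemma L2_cvg_dot (g_ : nat -> T -> R) g h :
  (forall n, L2 P (g_ n)) -> L2 P g -> L2 P h ->
  dot P (fun x => g_ n x - g x) (fun x => g_ n x - g x) @[n --> \oo] --> (0 : R) ->
  dot P (g_ n) h @[n --> \oo] --> dot P g h.
Proof.
move=> gL_ gL hL D0; apply/cvgrPdist_le => e e0.
(* The weight making the share of [h] in Young's inequality at most e; the added 1 keeps it positive
   when [h] has norm 0. *)
pose E := (dot P h h + 1) / e.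
have E0 : 0 < E by rewrite divr_gt0// ltr_wpDl// dot_ge0.
near=> n.
rewrite distrC -dotBl//.
have := dot_young E0 (L2B (gL_ n) gL) hL.
have H1 : E^-1 * dot P h h <= e.
  rewrite /E invf_div mulrAC ler_pdivrMr ?ltr_wpDl ?dot_ge0//.
  by rewrite ler_pM2l// lerDl.
have H2 : E * dot P (fun x => g_ n x - g x) (fun x => g_ n x - g x) <= e.
  rewrite -ler_pdivlMl// mulrC; near: n.
  by move/cvgr_le : D0; apply; rewrite divr_gt0.
by move: `|_| => z; lra.
Unshelve. all: by end_near.
Qed.

(** Dominated limits are limits in norm, so <r_n, f> is close to <r_n, f_m> for a suitable m,
    uniformly in n thanks to the bound [M]. *)
Lemma dominated_closed_cvg_dot (r_ : nat -> T -> R) (M : R) :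
  (forall n, L2 P (r_ n)) -> (forall n, dot P (r_ n) (r_ n) <= M) ->
  dominated_closed P
    [set h | L2 P h /\ dot P (r_ n) h @[n --> \oo] --> (0 : R)].
Proof.
move=> rL rM; split=> [a f g [fL f0] [gL g0]|f_ f g Kf gL f_g f_f].
  split; first exact: L2_lin.
  have -> : (fun n => dot P (r_ n) (fun x => a * f x + g x)) =
      (fun n => a * dot P (r_ n) f + dot P (r_ n) g).
    by apply/funext => n; rewrite dot_linr.
  rewrite -[X in _ --> X](addr0 (0 : R)) -[X in _ --> X + _](mulr0 a).
  by apply: cvgD => //; apply: cvgMr.
have f_L n : L2 P (f_ n) by have [] := Kf n.
have mf : measurable_fun setT f.
  by apply: (measurable_fun_cvg (h := f_)) => [n|x _]; [exact: (f_L n).1|exact: f_f].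
have fg x : `|f x| <= `|g x|.
  apply: (cvgr_to_le (cvg_norm (f_f x))); apply: nearW => n.
  by rewrite (le_trans (f_g n x))// ler_norm.
have fL : L2 P f by exact: (L2_le mf gL).
split=> //; apply/cvgrPdist_le => e e0.
have M0 : 0 <= M by exact: le_trans (dot_ge0 P (r_ 0%N)) (rM 0%N).
(* Chosen so that E |r_n|^2 <= e / 2; the index m below gives E^-1 |f_m - f|^2 <= e / 2. *)
pose E := e / (M + 1) / 2.
have E0 : 0 < E by rewrite !divr_gt0// ltr_wpDl.
have D0 := dot_cvgB (fun n => (f_L n).1) mf f_f gL f_g.
have [m Dm] : exists m, dot P (fun x => f_ m x - f x) (fun x => f_ m x - f x) <= E * (e / 2).
  have Ee : 0 < E * (e / 2) by rewrite mulr_gt0// divr_gt0.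
  have /cvgr_le/(_ _ Ee)[N _ HN] := D0.
  by exists N; apply: (HN N) => /=.
have [_ rm0] := Kf m.
near=> n.
rewrite sub0r normrN.
have -> : dot P (r_ n) f = dot P (r_ n) (f_ m) - dot P (fun x => f_ m x - f x) (r_ n).
  by rewrite dotBl// ![dot P (r_ n) _]dotC; ring.
have H1 : `|dot P (r_ n) (f_ m)| <= e / 2.
  near: n; have e2 : 0 < e / 2 by rewrite divr_gt0.
  by have /cvgrPdist_le/(_ _ e2) := rm0; apply: filterS => n; rewrite sub0r normrN.
have Ei0 : 0 < E^-1 by rewrite invr_gt0.
have := dot_young Ei0 (L2B (f_L m) fL) (rL n).
rewrite invrK => H2.
have H3 : E^-1 * dot P (fun x => f_ m x - f x) (fun x => f_ m x - f x) <= e / 2.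
  by rewrite ler_pdivrMl.
have H4 : E * dot P (r_ n) (r_ n) <= e / 2.
  apply: (@le_trans _ _ (E * (M + 1))); last by rewrite /E mulrAC divfK// gt_eqF// ltr_wpDl.
  by rewrite ler_pM2l// (le_trans (rM n))// lerDl.
rewrite (le_trans (ler_normB _ _))//.
by move: `|_| `|_| H1 H2 => y z; lra.
Unshelve. all: by end_near.
Qed.

End dot_limits.

(** * Orthogonal polynomials and polynomial regressions *)

Section orthogonal_basis.
Variables (R : realType) (mu : probability (measurableTypeR R) R).
Hypothesis mu_pow : forall k, L2 mu (fun x : measurableTypeR R => (x : R) ^+ k).
Variable alpha : nat -> {poly R}.
Hypothesis size_alpha : forall n, size (alpha n) = n.+1.

Lemma L2_poly (p : {poly R}) : L2 mu (fun x : measurableTypeR R => p.[x]).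
Proof.
have -> : (fun x : measurableTypeR R => p.[x]) =
    (fun x => \sum_(i < size p) p`_i * (x : R) ^+ i).
  by apply/funext => x; rewrite horner_coef.
by apply: L2_sum => i; exact: L2Z.
Qed.

(** The family is triangular: subtracting a multiple of [alpha n] cancels the coefficient at X^n. *)
Lemma poly_decomp n (p : {poly R}) : (size p <= n)%N ->
  exists a : nat -> R, p = \sum_(k < n) a k *: alpha k.
Proof.
elim: n p => [|n ih] p pn.
  by exists (fun=> 0); rewrite big_ord0; apply/eqP; rewrite -size_poly_leq0.
pose b := p`_n / lead_coef (alpha n).
have ln0 : lead_coef (alpha n) != 0 by rewrite lead_coef_eq0 -size_poly_eq0 size_alpha.
have [a aE] : exists a : nat -> R, p - b *: alpha n = \sum_(k < n) a k *: alpha k.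
  apply: ih; apply/leq_sizeP => j; rewrite leq_eqVlt => /orP[/eqP <-|nj].
    rewrite coefB coefZ (_ : (alpha n)`_n = lead_coef (alpha n)); last first.
      by rewrite lead_coefE size_alpha.
    by rewrite divfK// subrr.
  have aj : (alpha n)`_j = 0 by apply: nth_default; rewrite size_alpha.
  by rewrite coefB coefZ aj mulr0 subr0; apply: nth_default; apply: leq_trans nj.
exists (fun k => if k == n then b else a k).
rewrite big_ord_recr/= eqxx -[p in LHS](subrK (b *: alpha n)) aE; congr (_ + _).
by apply: eq_bigr => i _; rewrite ltn_eqF.
Qed.

Lemma poly_decomp_lead n (p : {poly R}) (a : nat -> R) : size p = n.+1 ->
  p = \sum_(k < n.+1) a k *: alpha k -> a n != 0.
Proof.
move=> pn pE; apply/negP => /eqP an0.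
suff : (size p <= n)%N by rewrite pn ltnn.
rewrite pE big_ord_recr/= an0 scale0r addr0.
apply: (leq_trans (size_sum _ _ _)); apply/bigmax_leqP => i _.
by rewrite (leq_trans (size_scale_leq _ _))// size_alpha.
Qed.

Lemma size_decomp n (a : nat -> R) : a n != 0 ->
  size (\sum_(k < n.+1) a k *: alpha k) = n.+1.
Proof.
move=> an0; rewrite big_ord_recr/= addrC size_polyDl size_scale ?size_alpha//.
rewrite ltnS; apply: (leq_trans (size_sum _ _ _)); apply/bigmax_leqP => i _.
by rewrite (leq_trans (size_scale_leq _ _))// size_alpha.
Qed.

Hypothesis alpha_orth :
  forall m n, m != n -> dot mu (fun x => (alpha m).[x]) (fun x => (alpha n).[x]) = 0.
Hypothesis alpha_norm : forall n, 0 < dot mu (fun x => (alpha n).[x]) (fun x => (alpha n).[x]).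

Lemma dot_decomp n (a : nat -> R) j :
  dot mu (fun x => (\sum_(k < n) a k *: alpha k).[x]) (fun x => (alpha j).[x]) =
  if (j < n)%N then a j * dot mu (fun x => (alpha j).[x]) (fun x => (alpha j).[x]) else 0.
Proof.
have -> : (fun x : measurableTypeR R => (\sum_(k < n) a k *: alpha k).[x]) =
   (fun x => \sum_(k < n) a k * (alpha k).[x]).
  by apply/funext => x; rewrite horner_sum; apply: eq_bigr => i _; rewrite hornerZ.
have pL := L2_poly; rewrite dot_suml//; last by move=> i; exact: L2Z.
under eq_bigr do rewrite dotZl//.
case: ifPn => jn.
  rewrite (bigD1 (Ordinal jn))//= big1 ?addr0// => i ij.
  by rewrite alpha_orth ?mulr0.
rewrite big1// => i _; rewrite alpha_orth ?mulr0// neq_ltn.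
by rewrite (leq_trans (ltn_ord i))// leqNgt.
Qed.

Lemma dot_orthogonal_small n (p : {poly R}) : (size p <= n)%N ->
  dot mu (fun x => p.[x]) (fun x => (alpha n).[x]) = 0.
Proof. by move=> /poly_decomp[a ->]; rewrite dot_decomp ltnn. Qed.

Lemma dot_orthogonal_lead n (p : {poly R}) : size p = n.+1 ->
  dot mu (fun x => p.[x]) (fun x => (alpha n).[x]) != 0.
Proof.
move=> pn; have [a aE] : exists a : nat -> R, p = \sum_(k < n.+1) a k *: alpha k.
  by apply: poly_decomp; rewrite pn.
rewrite [in dot _ _ _]aE dot_decomp ltnSn mulf_neq0 ?(poly_decomp_lead pn aE)//.
by rewrite gt_eqF.
Qed.

End orthogonal_basis.

(** The density form of E(X^n | Y) = p(Y): both sides are integrated over the events that Y lies in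
    B, the left one under the law [nu] of Y, the right one under [P] with weight [f]. *)
Definition polynomial_regression d (T : measurableType d) (R : realType)
    (P : probability T R) (f X Y : T -> R) (nu : probability (measurableTypeR R) R)
    (n : nat) : Prop :=
  exists p : {poly R}, size p = n.+1 /\
    forall B : set (measurableTypeR R), measurable B ->
      dot nu (fun y => p.[y]) \1_B = dot P f (fun w => X w ^+ n * \1_B (Y w)).

(** * The matrix of a density whose regressions are polynomial *)

Section regression.
Context d (T : measurableType d) (R : realType) (P : probability T R).
Variables (mu nu : probability (measurableTypeR R) R) (X Y : T -> R).
Hypothesis XY : product_law P mu nu X Y.
Hypothesis mu_pow : forall k, L2 mu (fun x : measurableTypeR R => (x : R) ^+ k).
Hypothesis nu_pow : forall k, L2 nu (fun x : measurableTypeR R => (x : R) ^+ k).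
Variable f : T -> R.
Hypothesis fL : L2 P f.

Lemma L2_poly_tensor (q : {poly R}) (v : R -> R) : L2 nu v ->
  L2 P (fun w => q.[X w] * v (Y w)).
Proof.
move=> vL; apply: (L2_tensor (u := fun x => q.[x]) (v := v) XY) => //.
exact: L2_poly.
Qed.

(* The indicators of a conditional expectation are replaced by square integrable
   functions, in particular by the [beta_n]. *)
Lemma regression_L2 n (p : {poly R}) :
  (forall B : set (measurableTypeR R), measurable B ->
      dot nu (fun y => p.[y]) \1_B = dot P f (fun w => X w ^+ n * \1_B (Y w))) ->
  forall v : R -> R, L2 nu v ->
    dot nu (fun y => p.[y]) v = dot P f (fun w => X w ^+ n * v (Y w)).
Proof.
move=> H v vL; have pL := L2_poly nu_pow p.
have XnL (u : R -> R) : L2 nu u -> L2 P (fun w => X w ^+ n * u (Y w)).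
  by move=> uL; apply: (L2_tensor (u := fun x => x ^+ n) XY).
pose K : set (measurableTypeR R -> R) := [set v | L2 nu v /\
  dot nu (fun y => p.[y]) v = dot P f (fun w => X w ^+ n * v (Y w))].
suff [] : K v by [].
have Kcl : dominated_closed nu K.
  split=> [a g h [gL gE] [hL hE]|g_ g h Kg hL g_h g_g].
    split; first exact: L2_lin.
    rewrite dot_linr// gE hE -dot_linr//; [|exact: XnL..].
    by apply: eq_dot => // w; ring.
  have g_L m : L2 nu (g_ m) by have [] := Kg m.
  have mg : measurable_fun setT g.
    by apply: (measurable_fun_cvg (h := g_)) => [m|x _]; [exact: (g_L m).1|exact: g_g].
  have gh x : `|g x| <= `|h x|.
    apply: (cvgr_to_le (cvg_norm (g_g x))); apply: nearW => m.
    by rewrite (le_trans (g_h m x))// ler_norm.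
  have gL : L2 nu g by exact: (L2_le mg hL).
  split => //.
  (* Both sides of the identity converge along [g_], so the limits agree. *)
  have C1 := dot_cvgr (fun m => (g_L m).1) mg g_g hL pL g_h.
  have C2 : dot P f (fun w => X w ^+ n * g_ m (Y w)) @[m --> \oo] -->
      dot P f (fun w => X w ^+ n * g (Y w)).
    apply: (dot_cvgr (g := fun w => `|X w ^+ n * h (Y w)|)) => //.
    - by move=> m; exact: (XnL _ (g_L m)).1.
    - exact: (XnL _ gL).1.
    - by move=> w; apply: cvgMr; exact: g_g.
    - by apply: L2_norm; exact: XnL.
    - by move=> m w; rewrite !normrM ler_wpM2l// (le_trans (g_h _ _))// ler_norm.
  have E : (fun m => dot P f (fun w => X w ^+ n * g_ m (Y w))) =
           (fun m => dot nu (fun y => p.[y]) (g_ m)).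
    by apply/funext => m; have [_ ->] := Kg m.
  rewrite E in C2.
  exact: (cvg_unique _ C1 C2).
apply: (dominated_closed_indic Kcl) => // B mB.
by split; [exact: L2_indic|exact: H].
Qed.

Hypothesis f_reg : forall n, polynomial_regression P f X Y nu n.

(** By linearity over the monomials of [q]; as [p k] has size k + 1, the top monomial alone decides
    the size of the sum. *)
Lemma regression_poly (q : {poly R}) : exists r : {poly R}, size r = size q /\
  forall v : R -> R, L2 nu v ->
    dot nu (fun y => r.[y]) v = dot P f (fun w => q.[X w] * v (Y w)).
Proof.
have [p pP] := choice f_reg.
exists (\sum_(k < size q) q`_k *: p k); split.
  have [->|q0] := eqVneq q 0; first by rewrite size_poly0 big_ord0 size_poly0.
  have : (0 < size q)%N by rewrite size_poly_gt0.
  case sq : (size q) => [//|n] _; apply: size_decomp; first by move=> k; have [] := pP k.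
  by have := lead_coefE q; rewrite sq => <-; rewrite lead_coef_eq0.
move=> v vL.
have -> : (fun y : measurableTypeR R => (\sum_(k < size q) q`_k *: p k).[y]) =
   (fun y => \sum_(k < size q) q`_k * (p k).[y]).
  by apply/funext => x; rewrite horner_sum; apply: eq_bigr => i _; rewrite hornerZ.
have pL k := L2_poly nu_pow (p k).
have XnL k : L2 P (fun w => X w ^+ k * v (Y w)).
  by apply: (L2_tensor (u := fun x => x ^+ k) XY).
rewrite dot_suml//; last by move=> i; exact: L2Z.
rewrite dotC; transitivity (dot P (fun w => \sum_(k < size q) q`_k * (X w ^+ k * v (Y w))) f).
  rewrite dot_suml//; last by move=> i; exact: L2Z.
  apply: eq_bigr => k _; rewrite !dotZl// (regression_L2 (pP k).2)//.
  by rewrite [in RHS]dotC.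
apply: eq_dot => // w; rewrite horner_coef mulr_suml.
by apply: eq_bigr => k _; rewrite mulrA.
Qed.

Variables alpha beta : nat -> {poly R}.
Hypothesis size_alpha : forall n, size (alpha n) = n.+1.
Hypothesis size_beta : forall n, size (beta n) = n.+1.
Hypothesis beta_orth :
  forall m n, m != n -> dot nu (fun x => (beta m).[x]) (fun x => (beta n).[x]) = 0.
Hypothesis beta_norm : forall n, 0 < dot nu (fun x => (beta n).[x]) (fun x => (beta n).[x]).

(** The entry equals <r, beta_n> with r of degree m < n. *)
Lemma regression_orthogonal m n : (m < n)%N ->
  dot P f (fun w => (alpha m).[X w] * (beta n).[Y w]) = 0.
Proof.
move=> mn; have [r [sr rE]] := regression_poly (alpha m).
rewrite -(rE (fun y => (beta n).[y]) (L2_poly nu_pow _)).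
by apply: (dot_orthogonal_small nu_pow size_beta beta_orth); rewrite sr size_alpha.
Qed.

(** Here r has degree exactly n: full order keeps zeros off the diagonal. *)
Lemma regression_diagonal n :
  dot P f (fun w => (alpha n).[X w] * (beta n).[Y w]) != 0.
Proof.
have [r [sr rE]] := regression_poly (alpha n).
rewrite -(rE (fun y => (beta n).[y]) (L2_poly nu_pow _)).
by apply: (dot_orthogonal_lead nu_pow size_beta beta_orth beta_norm); rewrite sr size_alpha.
Qed.

End regression.

(** * Diagonal expansions *)

Definition lancaster_sum (R : realType) (T : Type) (X Y : T -> R)
    (alpha beta : nat -> {poly R}) (c : nat -> R) (N : nat) (w : T) : R :=
  \sum_(n < N) c n * ((alpha n).[X w] * (beta n).[Y w]).

Section expansion.
Context d (T : measurableType d) (R : realType) (P : probability T R).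
Variables (mu nu : probability (measurableTypeR R) R) (X Y : T -> R).
Hypothesis XY : product_law P mu nu X Y.
Hypothesis mu_pow : forall k, L2 mu (fun x : measurableTypeR R => (x : R) ^+ k).
Hypothesis nu_pow : forall k, L2 nu (fun x : measurableTypeR R => (x : R) ^+ k).
Variables alpha beta : nat -> {poly R}.
Hypothesis size_alpha : forall n, size (alpha n) = n.+1.
Hypothesis size_beta : forall n, size (beta n) = n.+1.
Hypothesis alpha_orth :
  forall m n, m != n -> dot mu (fun x => (alpha m).[x]) (fun x => (alpha n).[x]) = 0.
Hypothesis alpha_norm : forall n, 0 < dot mu (fun x => (alpha n).[x]) (fun x => (alpha n).[x]).
Hypothesis beta_orth :
  forall m n, m != n -> dot nu (fun x => (beta m).[x]) (fun x => (beta n).[x]) = 0.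
Hypothesis beta_norm : forall n, 0 < dot nu (fun x => (beta n).[x]) (fun x => (beta n).[x]).

Let abL i j : L2 P (fun w => (alpha i).[X w] * (beta j).[Y w]).
Proof.
exact: (L2_poly_tensor XY mu_pow (alpha i) (v := fun y => (beta j).[y])
  (L2_poly nu_pow (beta j))).
Qed.

Lemma L2_lancaster_sum c N : L2 P (lancaster_sum X Y alpha beta c N).
Proof.
have tL (n : 'I_N) : L2 P (fun w => c n * ((alpha n).[X w] * (beta n).[Y w])).
  by apply: L2Z; exact: abL.
exact: L2_sum tL.
Qed.

Lemma dot_lancaster_sum c N (u v : R -> R) : L2 mu u -> L2 nu v ->
  dot P (lancaster_sum X Y alpha beta c N) (fun w => u (X w) * v (Y w)) =
  \sum_(n < N) c n * (dot mu (fun x => (alpha n).[x]) u * dot nu (fun y => (beta n).[y]) v).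
Proof.
move=> uL vL; have uvL := L2_tensor XY uL vL.
rewrite dot_suml//; last by move=> i; apply: L2Z; exact: (abL i i).
apply: eq_bigr => n _; rewrite dotZl//.
by rewrite (dot_tensor XY)//; exact: L2_poly.
Qed.

Variable f : T -> R.
Hypothesis fL : L2 P f.

(** Mean-square convergence lets the expansion be tested termwise against X^n 1_B(Y). As X^n
    involves only the [alpha k] with k <= n, a finite sum in the [beta k] remains, and its top
    coefficient contains c n. *)
Lemma lancaster_regression (c : nat -> R) : (forall n, c n != 0) ->
  dot P (fun w => lancaster_sum X Y alpha beta c N w - f w)
        (fun w => lancaster_sum X Y alpha beta c N w - f w)
    @[N --> \oo] --> (0 : R) ->
  forall n, polynomial_regression P f X Y nu n.
Proof.
move=> c0 cvgS n.
have [a aE] : exists a : nat -> R, 'X^n = \sum_(k < n.+1) a k *: alpha k.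
  by apply: (poly_decomp size_alpha); rewrite size_polyXn.
have an0 : a n != 0.
  by apply: (poly_decomp_lead size_alpha) aE; rewrite size_polyXn.
pose b k := a k * c k * dot mu (fun x => (alpha k).[x]) (fun x => (alpha k).[x]).
exists (\sum_(k < n.+1) b k *: beta k); split.
  by apply: size_decomp => //; rewrite !mulf_neq0// gt_eqF.
move=> B mB; have BL := L2_indic nu mB.
have XnL : L2 P (fun w => X w ^+ n * \1_B (Y w)).
  by apply: (L2_tensor (u := fun x => x ^+ n) XY).
have := L2_cvg_dot (L2_lancaster_sum c) fL XnL cvgS.
have dX k : dot mu (fun x => (alpha k).[x]) (fun x : measurableTypeR R => (x : R) ^+ n) =
    if (k < n.+1)%N then a k * dot mu (fun x => (alpha k).[x]) (fun x => (alpha k).[x]) else 0.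
  rewrite -(dot_decomp mu_pow alpha_orth) dotC; apply: eq_dot => // x.
  by rewrite -aE hornerXn.
have -> : dot nu (fun y => (\sum_(k < n.+1) b k *: beta k).[y]) \1_B =
   \sum_(k < n.+1) b k * dot nu (fun y => (beta k).[y]) \1_B.
  transitivity (dot nu (fun y => \sum_(k < n.+1) b k * (beta k).[y]) \1_B).
    by apply: eq_dot => // y; rewrite horner_sum; apply: eq_bigr => i _; rewrite hornerZ.
  have bL k := L2_poly nu_pow (beta k).
  rewrite dot_suml//; last by move=> i; exact: L2Z.
  by apply: eq_bigr => k _; rewrite dotZl.
move=> cvgd; apply: (cvg_unique _ _ cvgd) => //.
(* Terms with k > n vanish because [alpha k] is orthogonal to X^n, so the sequence is constant once
   N > n. *)
apply: cvg_near_cst; exists n.+1 => // N /= nN.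
rewrite (dot_lancaster_sum c N (mu_pow n) BL).
rewrite -(big_mkord xpredT (fun k => c k * (dot mu (fun x => (alpha k).[x])
  (fun x : measurableTypeR R => (x : R) ^+ n) * dot nu (fun y => (beta k).[y]) \1_B))).
rewrite (@big_cat_nat _ _ _ n.+1)//= [X in _ + X]big_nat_cond.
rewrite [X in _ + X]big1 ?addr0; last first.
  by move=> k /andP[/andP[nk _] _]; rewrite dX ltnNge nk mul0r mulr0.
rewrite big_mkord; apply: eq_bigr => k _; rewrite dX ltn_ord /b; ring.
Qed.

End expansion.

Section expansion_plane.
Variables (R : realType) (mu nu : probability (measurableTypeR R) R).
Let P : probability (measurableTypeR R * measurableTypeR R)%type R := (mu \x nu)%E.
Variable delta : R.
Hypothesis delta0 : 0 < delta.
Hypothesis mu_exp :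
  mu.-integrable setT (fun x : measurableTypeR R => (expR (delta * `|x : R|))%:E).
Hypothesis nu_exp :
  nu.-integrable setT (fun x : measurableTypeR R => (expR (delta * `|x : R|))%:E).
Variables alpha beta : nat -> {poly R}.
Hypothesis size_alpha : forall n, size (alpha n) = n.+1.
Hypothesis size_beta : forall n, size (beta n) = n.+1.
Hypothesis alpha_orth :
  forall m n, m != n -> dot mu (fun x => (alpha m).[x]) (fun x => (alpha n).[x]) = 0.
Hypothesis alpha_norm : forall n, 0 < dot mu (fun x => (alpha n).[x]) (fun x => (alpha n).[x]).
Hypothesis beta_orth :
  forall m n, m != n -> dot nu (fun x => (beta m).[x]) (fun x => (beta n).[x]) = 0.
Hypothesis beta_norm : forall n, 0 < dot nu (fun x => (beta n).[x]) (fun x => (beta n).[x]).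

Let e i j (z : measurableTypeR R * measurableTypeR R) : R :=
  (alpha i).[z.1] * (beta j).[z.2].

Variable f : measurableTypeR R * measurableTypeR R -> R.
Hypothesis fL : L2 P f.
Hypothesis f_diag : forall i j, i != j -> dot P f (e i j) = 0.

(** The Fourier coefficient of [f] along alpha_n(x) beta_n(y); the denominator is the squared norm
    of that product. *)
Definition lancaster_coef n : R :=
  dot P f (fun z => (alpha n).[z.1] * (beta n).[z.2]) /
  (dot mu (fun x => (alpha n).[x]) (fun x => (alpha n).[x]) *
   dot nu (fun x => (beta n).[x]) (fun x => (beta n).[x])).

Lemma lancaster_cvg :
  dot P (fun z => lancaster_sum fst snd alpha beta lancaster_coef N z - f z)
        (fun z => lancaster_sum fst snd alpha beta lancaster_coef N z - f z)
    @[N --> \oo] --> (0 : R).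
Proof.
have mu_pow := L2_exprn delta0 mu_exp; have nu_pow := L2_exprn delta0 nu_exp.
have XY : product_law P mu nu fst snd := @product_law_plane R mu nu.
set S := lancaster_sum fst snd alpha beta lancaster_coef.
have SL N : L2 P (S N) by exact: (L2_lancaster_sum XY).
have eL i j : L2 P (e i j).
  apply: (L2_tensor (u := fun x => (alpha i).[x]) (v := fun y => (beta j).[y]) XY);
  exact: L2_poly.
have Se N i j : dot P (S N) (e i j) = if (i == j) && (i < N)%N then dot P f (e i i) else 0.
  rewrite (dot_lancaster_sum XY mu_pow nu_pow _ _ _ _ _
    (u := fun x => (alpha i).[x]) (v := fun y => (beta j).[y])); [|exact: L2_poly..].
  have [<-{j}|ij] := eqVneq i j; last first.
    apply: big1 => k _; have [->|ki] := eqVneq (k : nat) i.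
      by rewrite (beta_orth ij) !mulr0.
    by rewrite (alpha_orth ki) mul0r mulr0.
  case: ifPn => /= iN.
    rewrite (bigD1 (Ordinal iN))//= big1 ?addr0 => [|k ki].
      by rewrite divfK// mulf_neq0// gt_eqF.
    by rewrite alpha_orth ?mul0r ?mulr0.
  apply: big1 => k _; rewrite alpha_orth ?mul0r ?mulr0// neq_ltn.
  by rewrite (leq_trans (ltn_ord k))// leqNgt.
pose r N z := f z - S N z.
have rL N : L2 P (r N) by exact: L2B.
(* For i < N the residue is orthogonal to every [e i j]: the coefficients cancel for i = j, and both
   terms vanish for i <> j. *)
have re N i j : (i < N)%N -> dot P (r N) (e i j) = 0.
  move=> iN; rewrite dotBl// Se iN andbT.
  by have [<-|ij] := eqVneq i j; [rewrite subrr|rewrite f_diag// subr0].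
have rS N : dot P (r N) (S N) = 0.
  rewrite dotC dot_suml//; last by move=> i; apply: L2Z; exact: (eL i i).
  apply: big1 => n _; rewrite dotZl//; last exact: (eL n n).
  by rewrite dotC (re N n n)// mulr0.
(* [S N] is the orthogonal projection of [f], so |r_N|^2 = <r_N, f>; Bessel's inequality bounds it
   next. *)
have rf N : dot P (r N) (r N) = dot P (r N) f.
  by rewrite {1}/r dotBl// ![dot P _ (r N)]dotC rS subr0.
have rM N : dot P (r N) (r N) <= dot P f f.
  have := rS N; rewrite rf !dotBl// => /eqP; rewrite subr_eq0 dotC => /eqP ->.
  by rewrite gerBl dot_ge0.
have Kcl := dominated_closed_cvg_dot rL rM.
set K := (K in dominated_closed _ K) in Kcl.
have Ke i j : K (e i j).
  split => //; apply: cvg_near_cst; exists i.+1 => // N /= iN; exact: re.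
(* Monomials are finite combinations of the [e k l], so the density theorem puts [f] itself into
   [K]. *)
have Kpow i j : K (fun z => (z.1 : R) ^+ i * (z.2 : R) ^+ j).
  have [a aE] : exists a : nat -> R, 'X^i = \sum_(k < i.+1) a k *: alpha k.
    by apply: (poly_decomp size_alpha); rewrite size_polyXn.
  have [b bE] : exists b : nat -> R, 'X^j = \sum_(k < j.+1) b k *: beta k.
    by apply: (poly_decomp size_beta); rewrite size_polyXn.
  have K0 : K (fun=> 0) by exact: (dominated_closed0 Kcl (Ke 0 0)).
  apply: (@dominated_closed_eq _ _ _
    (fun z => \sum_(k < i.+1) \sum_(l < j.+1) (a k * b l) * e k l z)).
    move=> z; rewrite -(hornerXn (z.1 : R) i) -(hornerXn (z.2 : R) j) aE bE.
    rewrite !horner_sum mulr_suml.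
    apply: eq_bigr => k _; rewrite mulr_sumr; apply: eq_bigr => l _.
    by rewrite !hornerZ /e; ring.
  apply: (dominated_closed_sum Kcl (F := fun (k : 'I_i.+1) z =>
    \sum_(l < j.+1) (a k * b l) * e k l z) _ K0) => k.
  apply: (dominated_closed_sum Kcl (F := fun (l : 'I_j.+1) z =>
    (a k * b l) * e k l z) _ K0) => l.
  exact: (dominated_closedZ Kcl).
have [_ Kf] : K f by exact: (dominated_closed_poly2_L2 delta0 mu_exp nu_exp Kcl Kpow fL).
have -> : (fun N => dot P (fun z => S N z - f z) (fun z => S N z - f z)) =
    (fun N => dot P (r N) f); last exact: Kf.
apply/funext => N; rewrite -rf; apply: eq_Rintegral => z _.
by rewrite /r; ring.
Qed.

End expansion_plane.

(** * The joint density and its conditional moments *)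

Section Cra_exponential.
Variables (R : realType) (mu : probability (measurableTypeR R) R).

(** A probability vanishes on the negative set of any Hahn decomposition, so its total variation is
    [mu] itself. *)
Lemma Cra_integrable_expR : Cra (charge_of_finite_measure mu) ->
  exists delta : R, 0 < delta /\
    mu.-integrable setT (fun x : measurableTypeR R => (expR (delta * `|x : R|))%:E).
Proof.
move=> [Pos [Neg [PN [delta [delta0 h]]]]]; exists delta; split => //.
apply/integrableP; split.
  apply/measurable_EFinP; apply: measurableT_comp => //.
  by apply: measurable_funM => //; exact: normr_measurable.
apply: le_lt_trans h.
under eq_integral do rewrite gee0_abs ?lee_fin ?expR_ge0//.
rewrite le_eqVlt; apply/orP; left; apply/eqP.
apply: eq_measure_integral => A mA _.
have [_ [mN N0] _ _] := PN.
have neg0 : jordan_neg PN A = 0%E.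
  rewrite jordan_negE cjordan_negE /crestr0 mem_set// /crestr.
  suff : mu (A `&` Neg) = 0%E by move=> h0; rewrite -[RHS]oppe0 -h0.
  apply/eqP; rewrite eq_le measure_ge0 andbT.
  exact: (N0 _ (measurableI _ _ mA mN) (@subIsetr _ _ _)).
have := jordan_decomp PN mA.
by rewrite /cadd/= /charge_variation cscaleN1 /= neg0 oppe0.
Qed.

Lemma integrable_expR_le (delta delta' : R) : delta' <= delta ->
  mu.-integrable setT (fun x : measurableTypeR R => (expR (delta * `|x : R|))%:E) ->
  mu.-integrable setT (fun x : measurableTypeR R => (expR (delta' * `|x : R|))%:E).
Proof.
move=> dd ie.
apply: (integrable_le (g := fun x : measurableTypeR R => expR (delta * `|x : R|)) _ ie).
  apply: measurableT_comp => //.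
  by apply: measurable_funM => //; exact: normr_measurable.
by move=> x; rewrite ger0_norm ?expR_ge0// ler_expR ler_wpM2r.
Qed.

End Cra_exponential.

(** * The support carries full measure *)

Section support.
Variables (R : realType) (mu : probability (measurableTypeR R) R).

(** A point outside the support has a null neighbourhood, hence lies in a null interval with
    rational endpoints; there are countably many of these. *)
Lemma msupport_setC : exists F : nat -> set (measurableTypeR R),
  (forall k, measurable (F k) /\ mu (F k) = 0%E) /\
  ~` msupport mu = \bigcup_k F k.
Proof.
pose G (pq : rat * rat) : set (measurableTypeR R) :=
  let I := `](ratr pq.1 : R), (ratr pq.2 : R)[%classic in
  if mu I == 0%E then I else set0.
have GP pq : measurable (G pq) /\ mu (G pq) = 0%E.
  by rewrite /G; case: ifPn => [/eqP//|_]; split.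
(* Integers coding no pair of rationals receive the empty set. *)
pose F k := if unpickle k is Some pq then G pq else set0.
have FG pq : F (pickle pq) = G pq by rewrite /F pickleK.
exists F; split.
  by move=> k; rewrite /F; case: (unpickle k) => [pq|]; [exact: GP|split].
apply/seteqP; split => [x|x [k _]].
  move=> /existsNP[U /not_implyP[[oU Ux] /negP]].
  rewrite lt0e measure_ge0 andbT negbK => /eqP U0.
  have /nbhs_ballP[e /= e0 eU] := open_nbhs_nbhs (conj oU Ux).
  have [p] : exists p : rat, ratr p \in `](x : R) - e, (x : R)[.
    by apply: rat_in_itvoo; rewrite ltrBlDr ltrDl.
  rewrite in_itv/= => /andP[p1 p2].
  have [q] : exists q : rat, ratr q \in `](x : R), (x : R) + e[.
    by apply: rat_in_itvoo; rewrite ltrDl.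
  rewrite in_itv/= => /andP[q1 q2].
  exists (pickle (p, q)); first exact: I.
  rewrite FG /G ifT; first by rewrite /= in_itv/= p2 q1.
  rewrite -measure_le0 -U0; apply: le_measure; rewrite ?inE.
  - exact: measurable_itv.
  - exact: open_measurable.
  move=> y; rewrite /= in_itv/= => /andP[y1 y2]; apply: eU.
  by rewrite /ball/= ltr_norml; apply/andP; split; lra.
rewrite /F; case: (unpickle k) => [pq|//].
rewrite /G; case: ifPn => [/eqP I0 xI|//] /(_ `](ratr pq.1 : R), (ratr pq.2 : R)[%classic).
rewrite I0 ltxx => h; suff : false by [].
by apply: h; split => //; exact: interval_open.
Qed.

Lemma measurable_msupport : measurable (msupport mu).
Proof.
have [F [FP FE]] := msupport_setC.
rewrite -(setCK (msupport mu)) FE; apply: measurableC.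
by apply: bigcup_measurable => k _; have [] := FP k.
Qed.

Lemma msupport_setC0 : mu (~` msupport mu) = 0%E.
Proof.
have [F [FP FE]] := msupport_setC.
apply/negligibleP; first exact: measurableC measurable_msupport.
rewrite FE; apply: negligible_bigcup => k; have [mF F0] := FP k.
exact/negligibleP.
Qed.

Lemma ge0_integral_msupport (g : measurableTypeR R -> \bar R) :
  measurable_fun setT g -> (forall x, 0 <= g x)%E ->
  (\int[mu]_(x in msupport mu) g x = \int[mu]_x g x)%E.
Proof.
move=> mg g0; rewrite [RHS](@ge0_negligible_integral _ _ _ mu setT (~` msupport mu))//.
- by rewrite setTD setCK.
- exact: measurableC measurable_msupport.
- exact: msupport_setC0.
Qed.

End support.

(** * Integrals of functions of one coordinate *)

Section image_law.
Context d (T : measurableType d) (R : realType) (F : probability T R).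
Variables (mu : probability (measurableTypeR R) R) (X : T -> measurableTypeR R).
Hypothesis mX : measurable_fun setT X.
Hypothesis lawX : forall A, measurable A -> F (X @^-1` A) = mu A.

Lemma integrable_law (u : measurableTypeR R -> R) :
  mu.-integrable setT (EFin \o u) -> F.-integrable setT (EFin \o (u \o X)).
Proof.
move=> ui; have mu_ := measurable_int mu ui.
apply/integrableP; split; first exact: (measurableT_comp mu_ mX).
have -> : (\int[F]_x `|(EFin \o (u \o X)) x| = \int[mu]_y `|(u y)%:E|)%E.
  transitivity (\int[pushforward F X]_y `|(u y)%:E|)%E.
    by rewrite ge0_integral_pushforward//; exact: measurableT_comp.
  by apply: eq_measure_integral => A mA _; exact: lawX.
by have /integrableP[] := ui.
Qed.

Lemma Rintegral_law (u : measurableTypeR R -> R) :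
  mu.-integrable setT (EFin \o u) -> (\int[F]_w u (X w) = \int[mu]_y u y)%R.
Proof.
move=> ui; have uF := integrable_law ui; rewrite /Rintegral; congr fine.
transitivity (\int[pushforward F X]_y (u y)%:E)%E.
  rewrite integral_pushforward//.
  exact: measurable_int ui.
by apply: eq_measure_integral => A mA _; exact: lawX.
Qed.

Lemma L2_law (u : measurableTypeR R -> R) : L2 mu u -> L2 F (u \o X).
Proof.
move=> [mu_ ui]; split; first exact: measurableT_comp.
exact: (integrable_law (u := fun x => u x ^+ 2)).
Qed.

End image_law.

Lemma integral_setE d (T : measurableType d) (R : realType) (P : probability T R)
    (h : T -> R) (D : set T) : measurable D -> P.-integrable setT (EFin \o h) ->
  (\int[P]_(w in D) (h w)%:E = (\int[P]_w (h w * \1_D w))%R%:E)%E.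
Proof.
move=> mD hi; rewrite integral_mkcond /Rintegral fineK.
  by apply: eq_integral => w _; rewrite patchE indicE; case: ifP => _; rewrite ?mulr1 ?mulr0.
apply: integrable_fin_num => //.
apply: (integrable_le (g := fun w => `|h w|)) => //.
- apply: measurable_funM; last exact: measurable_indic.
  by apply/measurable_EFinP; exact: measurable_int hi.
- exact: integrable_abse hi.
- by move=> w; rewrite normrM indicE; case: (w \in D); rewrite ?normr1 ?normr0 ?mulr1 ?mulr0.
Qed.

(** * Conditional moments as regressions of the density *)

Section conditional_moments.
Context d (T : measurableType d) (R : realType) (F P : probability T R).
Variables (mu nu : probability (measurableTypeR R) R) (X Y : T -> measurableTypeR R).
Hypotheses (mX : measurable_fun setT X) (mY : measurable_fun setT Y).
Hypothesis lawX : forall A, measurable A -> F (X @^-1` A) = mu A.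
Hypothesis lawY : forall A, measurable A -> F (Y @^-1` A) = nu A.
Hypothesis mu_pow : forall k, L2 mu (fun x : measurableTypeR R => (x : R) ^+ k).
Hypothesis nu_pow : forall k, L2 nu (fun x : measurableTypeR R => (x : R) ^+ k).
Variable f : T -> R.
Hypothesis fF : forall h : T -> R, F.-integrable setT (EFin \o h) ->
  (\int[F]_w h w)%R = dot P f h.

Lemma regression_integrals n (p : {poly R}) (B : set (measurableTypeR R)) :
  measurable B ->
  (\int[F]_(w in Y @^-1` B) (p.[Y w])%:E = (dot nu (fun y => p.[y]) \1_B)%:E)%E /\
  (\int[F]_(w in Y @^-1` B) (X w ^+ n)%:E =
    (dot P f (fun w => X w ^+ n * \1_B (Y w)))%:E)%E.
Proof.
move=> mB; have mYB : measurable (Y @^-1` B) by rewrite -[_ @^-1` _]setTI; exact: mY.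
have pL := L2_poly nu_pow p.
have BL := L2_indic nu mB.
have pF := L2_integrable (L2_law mY lawY pL).
have XF := L2_law mX lawX (mu_pow n).
split.
  rewrite (integral_setE (h := fun w => p.[Y w]))//; congr (_%:E).
  exact: (Rintegral_law mY lawY (u := fun y => p.[y] * \1_B y) (L2_integrableM pL BL)).
rewrite (integral_setE (h := fun w => (X w : R) ^+ n))//; last exact: L2_integrable.
congr (_%:E); rewrite -fF//.
exact: (L2_integrableM XF (L2_law mY lawY BL)).
Qed.

(** From left to right, the version [g] is exchanged for the polynomial under the integral; from
    right to left, the polynomial is its own Borel version. *)
Lemma polynomial_cond_momentsP : polynomial_cond_moments F X Y nu <->
  forall n, (1 <= n)%N -> polynomial_regression P f X Y nu n.
Proof.
split=> H n n1.
  have [p [pn [g [[_ mg gi gE] gp]]]] := H n n1; exists p; split => // B mB.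
  have mYB : measurable (Y @^-1` B) by rewrite -[_ @^-1` _]setTI; exact: mY.
  have [H1 H2] := regression_integrals n p mB.
  apply: EFin_inj; rewrite -H1 -H2 -gE//.
  apply: ae_eq_integral => //.
  - apply: measurable_funTS; apply/measurable_EFinP.
    exact: (L2_law mY lawY (L2_poly nu_pow p)).1.
  - by apply: measurable_funTS; exact: measurable_int gi.
  (* The exceptional [nu]-null set pulls back along [Y] to an [F]-null set. *)
  have [N [mN N0 gN]] := gp.
  exists (Y @^-1` N); split.
  - by rewrite -[_ @^-1` _]setTI; exact: mY.
  - exact: (etrans (lawY mN) N0).
  - move=> w /= h; apply: gN => /= E; apply: h => _; by rewrite E.
have [p [pn pE]] := H n n1; exists p; split => //; exists (fun y => p.[y]); split; last first.
  exact: aeW.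
have pF := L2_law mY lawY (L2_poly nu_pow p).
split.
- exact: (L2_integrable (L2_law mX lawX (mu_pow n))).
- exact: (L2_poly nu_pow p).1.
- exact: L2_integrable.
- by move=> B mB; have [-> ->] := regression_integrals n p mB; rewrite pE.
Qed.

(** Supplies degree 0, since [polynomial_cond_moments] starts at n = 1. *)
Lemma polynomial_regression0 : polynomial_regression P f X Y nu 0.
Proof.
exists 1; split; first by rewrite size_poly1.
move=> B mB; have [H1 _] := regression_integrals 0 1 mB.
have [_ H2] := regression_integrals 0 1 mB.
apply: EFin_inj; rewrite -H1 -H2; apply: eq_integral => w _.
by rewrite hornerC expr0.
Qed.

End conditional_moments.

(** * The Radon-Nikodym density of the joint law *)

Section density.
Variables (R : realType) (mu nu : probability (measurableTypeR R) R).
Variable F : probability (measurableTypeR R * measurableTypeR R)%type R.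
Let P : probability (measurableTypeR R * measurableTypeR R)%type R := (mu \x nu)%E.
Hypothesis Fac : F `<< (mu \x nu)%E.
Let FacP : charge_of_finite_measure F `<< P := Fac.
Let f z : R := fine (joint_density mu nu F z).

Lemma joint_densityE z : joint_density mu nu F z = (f z)%:E.
Proof. by rewrite /f fineK//; exact: (Radon_Nikodym_fin_num z FacP). Qed.

Lemma measurable_joint_density : measurable_fun setT f.
Proof.
apply/measurable_EFinP; rewrite (_ : EFin \o f = joint_density mu nu F); last first.
  by apply/funext => z; rewrite joint_densityE.
exact: measurable_int (Radon_Nikodym_integrable FacP).
Qed.

Lemma Rintegral_density (h : measurableTypeR R * measurableTypeR R -> R) :
  F.-integrable setT (EFin \o h) -> (\int[F]_w h w)%R = dot P f h.
Proof.
move=> hi; rewrite /dot /Rintegral; congr fine.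
rewrite -(Radon_Nikodym_change_of_variables FacP measurableT hi).
apply: eq_integral => z _; rewrite mulrC EFinM.
by congr (_ * _)%E; exact: joint_densityE.
Qed.

(** Tonelli, after the supports are dropped from the iterated integral because their complements are
    null. *)
Lemma L2_joint_density : square_integrable_density mu nu F -> L2 P f.
Proof.
move=> Fsq; have mf := measurable_joint_density; split => //.
have mf2 : measurable_fun setT (fun z => (f z ^+ 2)%:E).
  by apply/measurable_EFinP; exact: measurable_funX.
have f20 z : (0 <= (f z ^+ 2)%:E)%E by rewrite lee_fin sqr_ge0.
apply/integrableP; split => //.
under eq_integral do rewrite gee0_abs//.
apply: le_lt_trans Fsq.
rewrite fubini_tonelli1// /fubini_F.
under [X in (_ <= X)%E]eq_integral => x _.
  under eq_integral => y _ do rewrite joint_densityE -EFin_expe.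
  rewrite ge0_integral_msupport;
    [|exact: (measurableT_comp mf2 (pair1_measurable x))|by move=> y; exact: f20].
  over.
rewrite ge0_integral_msupport//.
- exact: (measurable_fun_fubini_tonelli_F _ mf2 f20).
- by move=> x; apply: integral_ge0.
Qed.

Lemma ae_msupport : {ae P, forall z, (msupport mu `*` msupport nu) z}.
Proof.
have mX := measurable_msupport mu; have mY := measurable_msupport nu.
exists (~` (msupport mu `*` msupport nu)); split => //.
  by apply: measurableC; exact: measurableX.
apply/eqP; rewrite probability_setC; last exact: measurableX.
have full (Q : probability (measurableTypeR R) R) : Q (msupport Q) = 1%E.
  have := msupport_setC0 Q; rewrite probability_setC; last exact: measurable_msupport.
  by move/eqP; rewrite sube_eq ?fin_num_measure// add0e => /eqP.
rewrite [X in (1 - X)%E](_ : _ = 1%E) ?subee//.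
apply: (etrans (product_measure1E mu nu mX mY)).
by rewrite -[RHS]mule1; congr (_ * _)%E; exact: full.
Qed.

(** The product of the supports has full measure, so the mean-square sum [s] agrees with [f] almost
    everywhere; conversely [f] serves as [s]. *)
Lemma lancaster_expansionP (alpha beta : nat -> {poly R}) (c : nat -> R) :
  L2 P f -> (forall N, L2 P (lancaster_sum fst snd alpha beta c N)) ->
  lancaster_expansion mu nu F alpha beta c <->
  dot P (fun z => lancaster_sum fst snd alpha beta c N z - f z)
        (fun z => lancaster_sum fst snd alpha beta c N z - f z)
    @[N --> \oo] --> (0 : R).
Proof.
move=> fL SL.
pose D N := dot P (fun z => lancaster_sum fst snd alpha beta c N z - f z)
        (fun z => lancaster_sum fst snd alpha beta c N z - f z).
have SE N z : \sum_(n < N) c n * (alpha n).[z.1] * (beta n).[z.2] =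
    lancaster_sum fst snd alpha beta c N z.
  by apply: eq_bigr => n _; rewrite mulrA.
have key N : (\int[P]_z ((lancaster_sum fst snd alpha beta c N z - f z) ^+ 2)%:E)%E =
    (D N)%:E.
  have DL := L2B (SL N) fL.
  rewrite /D /dot /Rintegral fineK; last first.
    by apply: integrable_fin_num => //; exact: L2_integrableM.
  by apply: eq_integral => z _; rewrite expr2.
split=> [[s [ms cvgs sE]]|cvgf].
  have sf : {ae P, forall z, f z = s z}.
    have sE' : {ae P, forall z, (msupport mu `*` msupport nu) z ->
       joint_density mu nu F z = (s z)%:E} := sE.
    have mS := ae_msupport; near=> z.
    have Sz : (msupport mu `*` msupport nu) z by near: z.
    have sz : (msupport mu `*` msupport nu) z -> joint_density mu nu F z = (s z)%:E by near: z.
    by apply: EFin_inj; rewrite -joint_densityE; exact: sz.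
  suff E : (fun N => \int[(mu \x nu)%E]_z
      ((\sum_(n < N) c n * (alpha n).[z.1] * (beta n).[z.2] - s z) ^+ 2)%:E)%E =
      (fun N => (D N)%:E).
    by move: cvgs; rewrite E => /fine_cvg.
  apply/funext => N; rewrite -key.
  apply: (@ae_eq_integral _ _ _ P _ _ _ measurableT) => /=.
  - apply/measurable_EFinP; apply: measurable_funX; apply: measurable_funB => //.
    by apply: eq_measurable_fun (SL N).1 => z _; rewrite SE.
  - apply/measurable_EFinP; apply: measurable_funX.
    by apply: measurable_funB; [exact: (SL N).1|exact: measurable_joint_density].
  - near=> z => _; rewrite SE; congr ((_ - _) ^+ 2)%:E; apply: esym.
    by near: z.
have E : (fun N => \int[(mu \x nu)%E]_z
      ((\sum_(n < N) c n * (alpha n).[z.1] * (beta n).[z.2] - f z) ^+ 2)%:E)%E =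
      (fun N => (D N)%:E).
  by apply/funext => N; rewrite -key; apply: eq_integral => z _; rewrite SE.
exists f; split.
- exact: measurable_joint_density.
- by rewrite E; apply: cvg_EFin => //; apply: nearW.
- by apply: aeW => z _; exact: joint_densityE.
Unshelve. all: by end_near.
Qed.

End density.

Lemma orthogonal_polynomials_dot (R : realType) (mu : probability (measurableTypeR R) R)
    (alpha : nat -> {poly R}) :
  (forall k, L2 mu (fun x : measurableTypeR R => (x : R) ^+ k)) ->
  orthogonal_polynomials mu alpha ->
  [/\ forall n, size (alpha n) = n.+1,
      forall m n, m != n ->
        dot mu (fun x => (alpha m).[x]) (fun x => (alpha n).[x]) = 0 &
      forall n, 0 < dot mu (fun x => (alpha n).[x]) (fun x => (alpha n).[x])].
Proof.
move=> mu_pow [sz orth norm]; split => // [m n mn|n].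
  by rewrite /dot /Rintegral orth.
have aL := L2_poly mu_pow (alpha n).
rewrite -lte_fin /dot /Rintegral fineK; last first.
  by apply: integrable_fin_num => //; exact: L2_integrableM.
apply: (lt_le_trans (norm n)); rewrite le_eqVlt; apply/orP; left; apply/eqP.
by apply: eq_integral => x _; rewrite expr2.
Qed.

Theorem theorem3 (R : realType) (mu nu : probability (measurableTypeR R) R)
  (F : probability (measurableTypeR R * measurableTypeR R)%type R)
  (alpha beta : nat -> {poly R})
  (Fmu : forall A : set (measurableTypeR R), measurable A ->
     pushforward F fst A = mu A)
  (Fnu : forall B : set (measurableTypeR R), measurable B ->
     pushforward F snd B = nu B)
  (Cra_mu : Cra (charge_of_finite_measure mu))
  (Cra_nu : Cra (charge_of_finite_measure nu))
  (alphaP : orthogonal_polynomials mu alpha)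
  (betaP : orthogonal_polynomials nu beta)
  (Fac : F `<< (mu \x nu)%E)
  (Fsq : square_integrable_density mu nu F) :
  LC mu nu F alpha beta <-> PC mu nu F.
Proof.
have [delta [d0 [mu_exp nu_exp]]] : exists delta : R, 0 < delta /\
    mu.-integrable setT (fun x : measurableTypeR R => (expR (delta * `|x : R|))%:E) /\
    nu.-integrable setT (fun x : measurableTypeR R => (expR (delta * `|x : R|))%:E).
  have [d1 [d10 h1]] := Cra_integrable_expR Cra_mu.
  have [d2 [d20 h2]] := Cra_integrable_expR Cra_nu.
  (* The density theorem on the plane takes one exponent for both margins. *)
  exists (Num.min d1 d2); split; first by rewrite lt_min d10.
  by split; [apply: integrable_expR_le h1|apply: integrable_expR_le h2];
    rewrite ge_min lexx ?orbT.
have mu_pow := L2_exprn d0 mu_exp; have nu_pow := L2_exprn d0 nu_exp.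
have [sa oa na] := orthogonal_polynomials_dot mu_pow alphaP.
have [sb ob nb] := orthogonal_polynomials_dot nu_pow betaP.
set P : probability (measurableTypeR R * measurableTypeR R)%type R := (mu \x nu)%E.
have XY : product_law P mu nu fst snd := @product_law_plane R mu nu.
(* With the coordinates exchanged, the same lemmas treat the regressions on X. *)
have YX : product_law P nu mu snd fst := product_law_sym XY.
pose f z : R := fine (joint_density mu nu F z).
have fL : L2 P f := L2_joint_density Fac Fsq.
have fF h : F.-integrable setT (EFin \o h) -> (\int[F]_w h w)%R = dot P f h :=
  @Rintegral_density R mu nu F Fac h.
have SL c N := L2_lancaster_sum XY mu_pow nu_pow alpha beta c N.
have mX : measurable_fun setT
    (fst : measurableTypeR R * measurableTypeR R -> measurableTypeR R).
  exact: measurable_fst.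
have mY : measurable_fun setT
    (snd : measurableTypeR R * measurableTypeR R -> measurableTypeR R).
  exact: measurable_snd.
have condY := polynomial_cond_momentsP mX mY Fmu Fnu mu_pow nu_pow fF.
have condX := polynomial_cond_momentsP mY mX Fnu Fmu nu_pow mu_pow fF.
split=> [[idm idn _ _ [c [c0 /(lancaster_expansionP Fac fL (SL c)) cvgS]]]|
         [idm idn /condY regY /condX regX]].
  split => //.
    apply/condY => n _.
    exact: (lancaster_regression XY mu_pow nu_pow sa sb oa na fL c0 cvgS n).
  apply/condX => n _.
  apply: (lancaster_regression YX nu_pow mu_pow sb sa ob nb fL c0) => //.
  have -> : lancaster_sum snd fst beta alpha c = lancaster_sum fst snd alpha beta c.
    apply/funext => N; apply/funext => z; apply: eq_bigr => k _.
    by rewrite [_.[z.2] * _]mulrC.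
  exact: cvgS.
have {}regY n : polynomial_regression P f fst snd nu n.
  case: n => [|n]; last exact: regY.
  exact: (polynomial_regression0 mX mY Fmu Fnu mu_pow nu_pow fF).
have {}regX n : polynomial_regression P f snd fst mu n.
  case: n => [|n]; last exact: regX.
  exact: (polynomial_regression0 mY mX Fnu Fmu nu_pow mu_pow fF).
(* The regression on Y annihilates the entries with i < j, the regression on X those with j < i. *)
have f_diag i j : i != j -> dot P f (fun z => (alpha i).[z.1] * (beta j).[z.2]) = 0.
  rewrite neq_ltn => /orP[ij|ji].
    exact: (regression_orthogonal XY mu_pow nu_pow fL regY sa sb ob ij).
  rewrite -(regression_orthogonal YX nu_pow mu_pow fL regX sb sa oa ji).
  by apply: eq_dot => // z; rewrite mulrC.
split => //; exists (lancaster_coef mu nu alpha beta f); split.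
  move=> n; rewrite mulf_neq0//.
    exact: (regression_diagonal XY mu_pow nu_pow fL regY sa sb ob nb).
  by rewrite invr_neq0// mulf_neq0// gt_eqF.
apply/(lancaster_expansionP Fac fL (SL _)).
exact: (lancaster_cvg d0 mu_exp nu_exp sa sb oa na ob nb fL f_diag).
Qed.
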